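(* Let $\underline{C}=(C_1,\ldots,C_d)$ be a row contraction on a Hilbert space $\mathcal{H}_C$ and let $\underline{E}$, $\underline{E}'$ be two minimal contractive liftings of $\underline{C}$, on $\mathcal{H}_E=\mathcal{H}_C\oplus\mathcal{H}_A$ and $\mathcal{H}_{E'}=\mathcal{H}_C\oplus\mathcal{H}_{A'}$ respectively. Then $\underline{E}$ and $\underline{E}'$ are unitarily equivalent (as liftings of $\underline{C}$) if and only if $\theta_{C,E}$ and $\theta_{C,E'}$ are equivalent.
   Context: A tuple $\underline{T}=(T_1,\ldots,T_d)$ of bounded operators on a Hilbert space $\mathcal{H}$ is a row contraction if $\sum_{i=1}^d T_iT_i^*\le I$; we view $\underline{T}=[T_1\ \cdots\ T_d]:\bigoplus_{i=1}^d\mathcal{H}\to\mathcal{H}$. Defect operators and spaces: $D_T=(I-\underline{T}^*\underline{T})^{1/2}$ on $\bigoplus_{i=1}^d\mathcal{H}$, $D_{*,T}=(I-\underline{T}\,\underline{T}^* )^{1/2}$ on $\mathcal{H}$, $\mathcal{D}_T=\overline{\mathrm{ran}}\,D_T$, $\mathcal{D}_{*,T}=\overline{\mathrm{ran}}\,D_{*,T}$. $\tilde\Lambda$ is the set of all finite words $\alpha=(\alpha_1,\ldots,\alpha_n)$ in $\{1,\ldots,d\}$ (including the empty word), $|\alpha|=n$, $T_\alpha=T_{\alpha_1}\cdots T_{\alpha_n}$ ($T_\emptyset=I$). $\Gamma$ is the full Fock space over $\mathbb{C}^d$ with vacuum vector $e_0$; $e_\alpha=e_{\alpha_1}\otimes\cdots\otimes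 e_{\alpha_n}$ ($e_\emptyset=e_0$). $\iota_j^{\mathcal{H}}:\mathcal{H}\to\bigoplus_{i=1}^d\mathcal{H}$ is the inclusion as $j$-th component and $P_k$ the $k$-th coordinate projection $\bigoplus_{i=1}^d\mathcal{H}\to\mathcal{H}$. A row contraction $\underline{E}$ on $\mathcal{H}_E=\mathcal{H}_C\oplus\mathcal{H}_A$ is a contractive lifting of $\underline{C}$ (by $\underline{A}$) if $E_i=\begin{bmatrix} C_i & 0 \\ B_i & A_i \end{bmatrix}$ for all $i$; it is minimal if $\mathcal{H}_E=\overline{\mathrm{span}}\{E_\alpha x:x\in\mathcal{H}_C,\alpha\in\tilde\Lambda\}$. With $\underline{B}=[B_1\ \cdots\ B_d]$, there is a unique contraction $\gamma:\mathcal{D}_{*,A}\to\mathcal{D}_C$ with $\underline{B}^*=D_C\gamma D_{*,A}$. The characteristic function (symbol) of the lifting is the operator $\theta_{C,E}:\mathcal{D}_E\to\Gamma\otimes\mathcal{D}_C$ determined, for $j=1,\dots,d$, $h_c\in\mathcal{H}_C$, $h_a\in\mathcal{H}_A$, by $$\theta_{C,E}D_E\iota_j^{\mathcal{H}_E}(h_c)=e_0\otimes\bigl(D_C\iota_j^{\mathcal{H}_C}(h_c)-\gamma D_{*,A}B_jh_c\bigr)-\sum_{|\alpha|\ge1}e_\alpha\otimes\gamma D_{*,A}A_\alpha^*B_jh_c,$$ $$\theta_{C,E}D_E\iota_j^{\mathcal{H}_E}(h_a)=-e_0\otimes\gamma\underline{A}D_A\iota_j^{\mathcal{H}_A}(h_a)+\sum_{k=1}^d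 e_k\otimes\sum_{\alpha}e_\alpha\otimes\gamma D_{*,A}A_\alpha^*P_kD_A^2\iota_j^{\mathcal{H}_A}(h_a).$$ Liftings $\underline{E},\underline{E}'$ of $\underline{C}$ are unitarily equivalent if there is a unitary $U:\mathcal{H}_A\to\mathcal{H}_{A'}$ with $\begin{bmatrix} I_{\mathcal{H}_C} & 0 \\ 0 & U \end{bmatrix}E_i=E_i'\begin{bmatrix} I_{\mathcal{H}_C} & 0 \\ 0 & U \end{bmatrix}$ for $i=1,\ldots,d$. Symbols $\theta_1:\mathcal{H}_1\to\Gamma\otimes\mathcal{H}$ and $\theta_2:\mathcal{H}_2\to\Gamma\otimes\mathcal{H}$ are equivalent if there is a unitary $v:\mathcal{H}_1\to\mathcal{H}_2$ with $\theta_1=\theta_2v$. *)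

(* Defs.v *)
From HB Require Import structures.
From mathcomp Require Import all_boot all_order all_algebra.
From mathcomp Require Import finmap.
From mathcomp Require Import all_classical all_reals all_analysis.
From mathcomp Require Import sesquilinear complex ring.
From mathcomp.analysis.showcase Require summability.

Set Implicit Arguments.
Unset Strict Implicit.
Unset Printing Implicit Defensive.

Import Order.TTheory GRing.Theory Num.Theory.
Import numFieldNormedType.Exports.

Local Open Scope classical_set_scope.
Local Open Scope ring_scope.
Local Open Scope complex_scope.

Lemma invSn_small (R : realType) (e : R[i]) : 0 < e ->
  exists N : nat, forall n, (N <= n)%N -> n.+1%:R^-1 <= e.
Proof.
move=> e0; have er : e = (complex.Re e)%:C by rewrite RRe_real// gtr0_real.
have e0' : 0 < complex.Re e by rewrite -ltcR -er.
have [N _ NP] := near_infty_natSinv_lt (PosNum e0').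
exists N => n Nn; rewrite er; have /= /ltW := NP n Nn.
by rewrite -lecR fmorphV/= rmorph_nat.
Qed.

(* A complex Hilbert space: a complete normed R[i]-module whose norm comes from
   an inner product, linear in its first argument. *)
HB.mixin Record NormedModule_isHilbert (R : realType) H
    & CompleteNormedModule R[i] H := {
  hdot : H -> H -> R[i] ;
  hdotP : forall (a : R[i]) u v w, hdot (a *: u + v) w = a * hdot u w + hdot v w ;
  hdotC : forall u v, hdot u v = Num.conj (hdot v u) ;
  hnormE : forall u, `|u| ^+ 2 = hdot u u
}.

#[short(type="hilbertType")]
HB.structure Definition Hilbert (R : realType) :=
  {H of CompleteNormedModule R[i] H & NormedModule_isHilbert R H}.

Definition dot_cauchy (R : realType) (H : zmodType) (dot : H -> H -> R[i])
    (u : nat -> H) := forall e : R[i], 0 < e -> exists N : nat, forall m n,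
  (N <= m)%N -> (N <= n)%N -> dot (u m - u n) (u m - u n) <= e.

Definition dot_cvg (R : realType) (H : zmodType) (dot : H -> H -> R[i])
    (u : nat -> H) (l : H) := forall e : R[i], 0 < e -> exists N : nat, forall n,
  (N <= n)%N -> dot (u n - l) (u n - l) <= e.

HB.factory Record Lmodule_isHilbert (R : realType) H & GRing.Lmodule R[i] H := {
  dot : H -> H -> R[i] ;
  dotP : forall (a : R[i]) u v w, dot (a *: u + v) w = a * dot u w + dot v w ;
  dotC : forall u v, dot u v = Num.conj (dot v u) ;
  dot_gt0 : forall u, u != 0 -> 0 < dot u u ;
  dot_complete : forall u : nat -> H, dot_cauchy dot u -> exists l, dot_cvg dot u l
}.

HB.builders Context (R : realType) H & Lmodule_isHilbert R H.

Lemma dot0l w : dot 0 w = 0.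
Proof. by have := dotP (-1) 0 0 w; rewrite scaler0 add0r mulN1r addNr. Qed.
Lemma dotDl u v w : dot (u + v) w = dot u w + dot v w.
Proof. by rewrite -[u]scale1r dotP mul1r scale1r. Qed.
Lemma dotZl a u w : dot (a *: u) w = a * dot u w.
Proof. by rewrite -[a *: u]addr0 dotP dot0l addr0. Qed.
Lemma dotDr u v w : dot u (v + w) = dot u v + dot u w.
Proof. by rewrite dotC dotDl rmorphD /= -!dotC. Qed.
Lemma dotZr a u w : dot u (a *: w) = Num.conj a * dot u w.
Proof. by rewrite dotC dotZl rmorphM /= -dotC. Qed.
Lemma dot_ge0 u : 0 <= dot u u.
Proof.
by have [->|/dot_gt0/ltW//] := eqVneq u 0; rewrite dot0l.
Qed.

Let norm u := sqrtC (dot u u).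

Let norm_ge0 u : 0 <= norm u.
Proof. by rewrite sqrtC_ge0 dot_ge0. Qed.

Let normK u : norm u ^+ 2 = dot u u.
Proof. exact: sqrtCK. Qed.

Lemma dot_CS u v : `|dot u v| <= norm u * norm v.
Proof.
have [->|v0] := eqVneq v 0.
  by rewrite dotC dot0l rmorph0 normr0; apply: mulr_ge0; apply: norm_ge0.
rewrite -ler_sqr ?nnegrE ?mulr_ge0 ?norm_ge0// exprMn !normK.
have vv0 := dot_gt0 v0.
pose a := dot u v / dot v v.
have : 0 <= dot (u - a *: v) (u - a *: v) by exact: dot_ge0.
rewrite -scaleNr !(dotDl, dotDr, dotZl, dotZr) rmorphN/=.
have -> : Num.conj a = Num.conj (dot u v) / dot v v.
  by rewrite /a rmorphM/= fmorphV/= -(dotC v v).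
set d := dot u v; set D := dot v v.
have -> : dot v u = Num.conj d by rewrite dotC.
rewrite normCK -(pmulr_rge0 _ vv0) -/D => h; rewrite -subr_ge0.
move: h; congr (0 <= _); rewrite /a -/d -/D.
have D0 : D != 0 by rewrite gt_eqF.
by field.
Qed.

Let normD u v : norm (u + v) <= norm u + norm v.
Proof.
rewrite -ler_sqr ?nnegrE ?addr_ge0 ?norm_ge0// sqrrD !normK dotDl !dotDr.
rewrite -addrA -[leRHS]addrA lerD2l addrA lerD2r.
rewrite [dot v u]dotC.
have dr : dot u v + Num.conj (dot u v) \is Num.real by rewrite CrealE rmorphD/= conjCK addrC.
apply: le_trans (real_ler_norm dr) _.
apply: le_trans (ler_normD _ _) _.
by rewrite norm_conjC -mulr2n lerMn2r/= dot_CS.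
Qed.

Let normZ (a : R[i]) u : norm (a *: u) = `|a| * norm u.
Proof.
by rewrite /norm dotZl dotZr mulrA -normCK sqrtCM ?nnegrE ?exprn_ge0 ?dot_ge0// sqrCK.
Qed.

Let norm0_eq0 u : norm u = 0 -> u = 0.
Proof.
move=> /eqP; rewrite sqrtC_eq0; have [//|/dot_gt0 + /eqP E] := eqVneq u 0.
by rewrite E ltxx.
Qed.

HB.instance Definition _ := Lmodule_isNormed.Build R[i] H normD normZ norm0_eq0.

Let normE u : `|u| ^+ 2 = dot u u.
Proof. exact: normK. Qed.

Let complete_H (F : set_system H) : ProperFilter F -> cauchy F -> cvg F.
Proof.
move=> FF Fc.
have {}Fc : forall e : R[i], 0 < e -> exists x, F (ball x e).
  exact/cauchyP.
have /choice [u uP] : forall n : nat, exists x : H, F (ball x (n.+1%:R^-1 : R[i])).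
  by move=> n; apply: Fc; rewrite invr_gt0.
have half0 (e : R[i]) : 0 < e -> 0 < e / 2 by move=> e0; rewrite divr_gt0.
have [e e0|l lP] := dot_complete (u := u).
  have s0 : 0 < sqrtC e by rewrite sqrtC_gt0.
  have [N NP] := invSn_small (half0 _ s0).
  exists N => m n Nm Nn.
  have [x []] := filter_ex (filterI (uP m) (uP n)).
  rewrite -!ball_normE /= => um un.
  rewrite -normE -[leRHS]sqrtCK ler_sqr ?nnegrE ?(ltW s0)//.
  rewrite [sqrtC e]splitr (le_trans (ler_distD x _ _))// lerD//.
    by rewrite (le_trans (ltW um))// NP.
  by rewrite distrC (le_trans (ltW un))// NP.
apply/cvg_ex; exists l; apply/cvg_ballP => e e0.
have [N1 N1P] := invSn_small (half0 _ e0).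
have [|N2 N2P] := lP ((e / 2) ^+ 2); first by rewrite exprn_gt0// half0.
pose n := maxn N1 N2.
apply: filterS (uP n) => x; rewrite -!ball_normE /= => ux.
rewrite [e]splitr (le_lt_trans (ler_distD (u n) _ _))// ler_ltD//.
  have := N2P n (leq_maxr _ _); rewrite -normE ler_sqr ?nnegrE ?(ltW (half0 _ e0))//.
  by rewrite distrC.
by rewrite (lt_le_trans ux)// N1P// leq_maxl.
Qed.

HB.instance Definition _ := Uniform_isComplete.Build H complete_H.
HB.instance Definition _ := NormedModule_isHilbert.Build R H dotP dotC normE.
HB.end.

Section hilbert_theory.
Context {R : realType} {H : hilbertType R}.
Implicit Types u v w : H.

Lemma hdot_linear w : linear_for *%R (@hdot R H ^~ w).
Proof. by move=> a u v; rewrite hdotP. Qed.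

Lemma hdot_conjlinear w : linear_for (Num.conj \; *%R) (@hdot R H w).
Proof.
by move=> a u v /=; rewrite hdotC hdotP rmorphD rmorphM/= -!hdotC.
Qed.

HB.instance Definition _ := bilinear_isBilinear.Build R[i] H H R[i]
  *%R (Num.conj \; *%R) (@hdot R H) (hdot_linear, hdot_conjlinear).

Lemma hdot_herm u v : hdot u v = (-1) ^+ false * Num.conj (hdot v u).
Proof. by rewrite expr0 mul1r hdotC. Qed.

HB.instance Definition _ :=
  isHermitianSesquilinear.Build R[i] H false Num.conj (@hdot R H) hdot_herm.

Lemma hdot_gt0 u : u != 0 -> 0 < hdot u u.
Proof. by move=> u0; rewrite -hnormE exprn_gt0// normr_gt0. Qed.

HB.instance Definition _ := isDotProduct.Build R[i] H (@hdot R H) hdot_gt0.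

Lemma hdot_complete (u : nat -> H) :
  dot_cauchy (@hdot R H) u -> exists l, dot_cvg (@hdot R H) u l.
Proof.
move=> uc.
have /cauchy_cvgP/cvg_ex[l /cvgrPdist_le ul] : cauchy (u @ \oo).
  apply: cauchy_exP => e e0.
  have [|N NP] := uc ((e / 2) ^+ 2); first by rewrite exprn_gt0// divr_gt0.
  exists (u N); exists N => // n /= Nn; rewrite -ball_normE /=.
  have := NP N n (leqnn _) Nn; rewrite -hnormE ler_sqr ?nnegrE ?divr_ge0 ?(ltW e0)//.
  by move=> /le_lt_trans; apply; rewrite ltr_pdivrMr// ltr_pMr// ltr1n.
exists l => e e0; have [|N _ NP] := ul (sqrtC e); first by rewrite sqrtC_gt0.
exists N => n Nn; rewrite -hnormE -[leRHS]sqrtCK ler_sqr ?nnegrE ?sqrtC_ge0 ?(ltW e0)//.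
by rewrite distrC NP.
Qed.

End hilbert_theory.

(* R[i] as a one-dimensional Hilbert space. *)
Definition scalars (R : realType) : Type := R[i].

Section scalars.
Context {R : realType}.
HB.instance Definition _ := GRing.Lmodule.copy (scalars R) (R[i])^o.

Let dot (x y : scalars R) : R[i] := (x : R[i]) * Num.conj (y : R[i]).

Let dotP a u v w : dot (a *: u + v) w = a * dot u w + dot v w.
Proof. by rewrite /dot mulrDl -mulrA. Qed.

Let dotC u v : dot u v = Num.conj (dot v u).
Proof. by rewrite /dot rmorphM/= conjCK mulrC. Qed.

Let dot_gt0 u : u != 0 -> 0 < dot u u.
Proof. by move=> u0; rewrite /dot -normCK exprn_gt0// normr_gt0. Qed.

Let dot_complete u : dot_cauchy dot u -> exists l, dot_cvg dot u l.
Proof.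
move=> uc.
have normE (z : R[i]) : dot z z = ((complex.Re z) ^+ 2 + (complex.Im z) ^+ 2)%:C.
  by rewrite /dot -normCK normc_def -rmorphXn/= sqr_sqrtr ?addr_ge0 ?sqr_ge0.
have real_cvg (v : R ^nat) :
    (forall e, 0 < e -> exists N : nat, forall m n, (N <= m)%N -> (N <= n)%N ->
       (v m - v n) ^+ 2 <= e) ->
    exists l, forall e, 0 < e -> exists N : nat, forall n, (N <= n)%N -> (v n - l) ^+ 2 <= e.
  move=> vc.
  have /cauchy_cvgP/cvg_ex[l /cvgrPdist_le vl] : cauchy (v @ \oo).
    apply: cauchy_exP => e e0.
    have [|N NP] := vc ((e / 2) ^+ 2); first by rewrite exprn_gt0// divr_gt0.
    exists (v N); exists N => // n /= Nn; rewrite -ball_normE /=.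
    have := NP N n (leqnn _) Nn.
    rewrite -[leLHS]real_normK ?num_real// ler_sqr ?nnegrE ?divr_ge0 ?(ltW e0)//.
    by move=> /le_lt_trans; apply; rewrite ltr_pdivrMr// ltr_pMr// ltr1n.
  exists l => e e0; have [|N _ NP] := vl (Num.sqrt e); first by rewrite sqrtr_gt0.
  exists N => n Nn; rewrite -[leRHS]sqr_sqrtr ?(ltW e0)//.
  rewrite -[leLHS]real_normK ?num_real// ler_sqr ?nnegrE ?sqrtr_ge0//.
  by rewrite distrC NP.
have uc' e : 0 < e -> exists N : nat, forall m n, (N <= m)%N -> (N <= n)%N ->
    (complex.Re (u m) - complex.Re (u n)) ^+ 2
     + (complex.Im (u m) - complex.Im (u n)) ^+ 2 <= e.
  move=> e0; have [|N NP] := uc e%:C; first by rewrite ltcR.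
  exists N => m n Nm Nn; have := NP m n Nm Nn; rewrite normE lecR.
  by rewrite !raddfB.
have [|a aP] := real_cvg (fun n => complex.Re (u n)).
  move=> e /uc'[N NP]; exists N => m n Nm Nn.
  by apply: le_trans (NP m n Nm Nn); rewrite lerDl sqr_ge0.
have [|b bP] := real_cvg (fun n => complex.Im (u n)).
  move=> e /uc'[N NP]; exists N => m n Nm Nn.
  by apply: le_trans (NP m n Nm Nn); rewrite lerDr sqr_ge0.
exists (a +i* b) => e e0.
have er : e = (complex.Re e)%:C by rewrite RRe_real// gtr0_real.
have e0' : 0 < complex.Re e / 2 by rewrite divr_gt0// -ltcR -er.
have [N1 N1P] := aP _ e0'; have [N2 N2P] := bP _ e0'.
exists (maxn N1 N2) => n; rewrite geq_max => /andP[/N1P h1 /N2P h2].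
rewrite normE er lecR [leRHS]splitr lerD//.
  by rewrite raddfB.
by rewrite raddfB.
Qed.

HB.instance Definition _ := Lmodule_isHilbert.Build R (scalars R)
  dotP dotC dot_gt0 dot_complete.

Lemma scalars_dotE (x y : scalars R) : hdot x y = (x : R[i]) * Num.conj (y : R[i]).
Proof. by []. Qed.

End scalars.

(* The product type and the type of finite functions are renamed because their
   Hilbert norm is not the supremum norm that the library puts on products. *)
Definition hsum (R : realType) (H K : hilbertType R) : Type := (H * K)%type.

Section hsum.
Context {R : realType} {H K : hilbertType R}.
HB.instance Definition _ := GRing.Lmodule.copy (hsum H K) (H * K)%type.

Let dot (x y : hsum H K) : R[i] := hdot x.1 y.1 + hdot x.2 y.2.

Let dotP a u v w : dot (a *: u + v) w = a * dot u w + dot v w.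
Proof. by rewrite /dot !hdotP mulrDr addrACA. Qed.

Let dotC u v : dot u v = Num.conj (dot v u).
Proof. by rewrite /dot rmorphD/= -!hdotC. Qed.

Let dot_gt0 u : u != 0 -> 0 < dot u u.
Proof.
case: u => x y; rewrite /dot/= => xy0.
rewrite lt_def addr_ge0 ?dnorm_ge0// andbT paddr_eq0 ?dnorm_ge0// !dnorm_eq0.
by apply: contraNN xy0 => /andP[/eqP -> /eqP ->].
Qed.

Let dot_complete u : dot_cauchy dot u -> exists l, dot_cvg dot u l.
Proof.
move=> uc.
have [|a aP] := @hdot_complete R H (fun n => (u n).1).
  move=> e /uc[N NP]; exists N => m n Nm Nn.
  by apply: le_trans (NP m n Nm Nn); rewrite lerDl dnorm_ge0.
have [|b bP] := @hdot_complete R K (fun n => (u n).2).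
  move=> e /uc[N NP]; exists N => m n Nm Nn.
  by apply: le_trans (NP m n Nm Nn); rewrite lerDr dnorm_ge0.
exists (a, b) => e e0.
have e0' : 0 < e / 2 by rewrite divr_gt0.
have [N1 N1P] := aP _ e0'; have [N2 N2P] := bP _ e0'.
exists (maxn N1 N2) => n; rewrite geq_max => /andP[/N1P h1 /N2P h2].
by rewrite [leRHS]splitr lerD.
Qed.

HB.instance Definition _ := Lmodule_isHilbert.Build R (hsum H K)
  dotP dotC dot_gt0 dot_complete.

Lemma hsum_dotE (x y : hsum H K) : hdot x y = hdot x.1 y.1 + hdot x.2 y.2.
Proof. by []. Qed.

End hsum.

Definition hpow (R : realType) (d : nat) (H : hilbertType R) : Type :=
  {ffun 'I_d -> H}.

Section hpow.
Context {R : realType} {d : nat} {H : hilbertType R}.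
HB.instance Definition _ := GRing.Lmodule.copy (hpow d H) {ffun 'I_d -> H}.

Let dot (x y : hpow d H) : R[i] := \sum_(i < d) hdot (x i) (y i).

Let dotP a u v w : dot (a *: u + v) w = a * dot u w + dot v w.
Proof.
rewrite /dot mulr_sumr -big_split/=; apply: eq_bigr => i _.
by rewrite !ffunE hdotP.
Qed.

Let dotC u v : dot u v = Num.conj (dot v u).
Proof. by rewrite /dot rmorph_sum/=; apply: eq_bigr => i _; rewrite hdotC. Qed.

Let dot_gt0 u : u != 0 -> 0 < dot u u.
Proof.
move=> u0; rewrite lt_def sumr_ge0 ?andbT; last by move=> i _; exact: dnorm_ge0.
apply: contraNN u0 => /eqP; rewrite /dot => /psumr_eq0P u0.
apply/eqP/ffunP => i; rewrite ffunE; apply/eqP; rewrite -(dnorm_eq0 (@hdot R H)).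
by apply/eqP/u0 => // j _; exact: dnorm_ge0.
Qed.

Let dot_complete u : dot_cauchy dot u -> exists l, dot_cvg dot u l.
Proof.
move=> uc.
have /choice[l lP] : forall i, exists l, dot_cvg (@hdot R H) (fun n => u n i) l.
  move=> i; apply: hdot_complete => e /uc[N NP]; exists N => m n Nm Nn.
  apply: le_trans (NP m n Nm Nn); rewrite /dot (bigD1 i)//= !ffunE lerDl.
  by apply: sumr_ge0 => j _; exact: dnorm_ge0.
exists [ffun i => l i] => e e0.
have e0' : 0 < e / d.+1%:R by rewrite divr_gt0.
have /choice[N NP] := fun i => lP i _ e0'.
exists (\max_i N i)%N => n Nn.
have -> : e = \sum_(i < d.+1) (e / d.+1%:R).
  by rewrite sumr_const card_ord -[RHS]mulr_natr divfK// pnatr_eq0.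
rewrite big_ord_recr/= -[leLHS]addr0 lerD ?(ltW e0')//; apply: ler_sum => i _.
by rewrite !ffunE; apply: NP; apply: leq_trans Nn; rewrite leq_bigmax.
Qed.

HB.instance Definition _ := Lmodule_isHilbert.Build R (hpow d H)
  dotP dotC dot_gt0 dot_complete.

Lemma hpow_dotE (x y : hpow d H) : hdot x y = \sum_(i < d) hdot (x i) (y i).
Proof. by []. Qed.

End hpow.

Section unordered_sums.
Context {R : realType} {I : choiceType}.
#[local] Existing Instance summability.totally_filter.

Lemma lec_approx (c l : R[i]) :
  (forall e : R[i], 0 < e -> exists2 y, c <= y & `|l - y| <= e) -> c <= l.
Proof.
move=> h; have hR e : 0 < e -> exists2 y : R[i], c <= y & `|l - y| <= e%:C.
  by move=> e0; apply: h; rewrite ltcR.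
rewrite lecE; apply/andP; split.
  rewrite -subr_eq0 -normr_le0; apply/ler_addgt0Pl => e /hR[y cy ly].
  rewrite addr0 -lecR (le_trans _ ly)//.
  have -> : complex.Im l - complex.Im c = complex.Im (l - y).
    have -> : complex.Im (l - y) = complex.Im l - complex.Im y by case: (l) (y) => ? ? [].
    by move: cy; rewrite lecE => /andP[/eqP -> _].
  rewrite normc_def lecR -sqrtr_sqr ler_wsqrtr// lerDr sqr_ge0//.
apply/ler_addgt0Pl => e /hR[y cy ly].
move: cy; rewrite lecE => /andP[_ cy]; rewrite (le_trans cy)// -lerBlDr.
rewrite -raddfB (le_trans (ler_norm _))// -lecR (le_trans (normc_ge_Re _))//.
by rewrite distrC.
Qed.

Lemma gec_approx (c l : R[i]) :
  (forall e : R[i], 0 < e -> exists2 y, y <= c & `|l - y| <= e) -> l <= c.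
Proof.
move=> h; rewrite -lerN2; apply: lec_approx => e /h[y yc ly].
by exists (- y); rewrite ?lerN2// -opprD normrN.
Qed.

Lemma big_fsetU_disj (V : zmodType) (a : I -> V) (A B : {fset I}) :
  (forall i, i \in B -> i \notin A) ->
  \sum_(i <- (A `|` B)%fset) a i = \sum_(i <- A) a i + \sum_(i <- B) a i.
Proof.
move=> AB; rewrite -big_cat; apply: perm_big; apply: uniq_perm.
- exact: fset_uniq.
- rewrite cat_uniq !fset_uniq/= andbT; apply/hasPn => i iB; exact: AB.
- by move=> i; rewrite in_fsetU mem_cat.
Qed.

Lemma big_fset_sub (V : zmodType) (a : I -> V) (A B : {fset I}) : (A `<=` B)%fset ->
  \sum_(i <- B) a i = \sum_(i <- A) a i + \sum_(i <- (B `\` A)%fset) a i.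
Proof.
move=> AB; rewrite -big_fsetU_disj; last by move=> i; rewrite in_fsetD => /andP[].
by rewrite fsetUDl fsetDv fsetD0; rewrite (fsetUidPr _ _ AB).
Qed.

Lemma bounded_tail (a : I -> R[i]) (M : R[i]) : (forall i, 0 <= a i) ->
  (forall A : {fset I}, \sum_(i <- A) a i <= M) ->
  forall e : R[i], 0 < e -> exists A0 : {fset I}, forall B : {fset I},
    (forall i, i \in B -> i \notin A0) -> \sum_(i <- B) a i <= e.
Proof.
move=> a0 aM e e0.
pose s (A : {fset I}) : R := complex.Re (\sum_(i <- A) a i).
have sE (A : {fset I}) : \sum_(i <- A) a i = (s A)%:C.
  by rewrite RRe_real// ger0_real// sumr_ge0.
have er : e = (complex.Re e)%:C by rewrite RRe_real// gtr0_real.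
have e0' : 0 < complex.Re e by rewrite -ltcR -er.
have hs : has_sup (range s).
  split; first by exists (s fset0), fset0.
  exists (complex.Re M) => _ [A _ <-]; have := aM A; rewrite lecE => /andP[_].
  by [].
have [_ [A0 _ <-] A0P] := sup_adherent e0' hs.
exists A0 => B AB.
have : s (A0 `|` B)%fset <= sup (range s).
  by apply: sup_upper_bound => //; exists (A0 `|` B)%fset.
rewrite {1}/s big_fsetU_disj// raddfD/= => h.
rewrite sE er lecR.
move: h A0P; rewrite -/(s A0) -/(s B) -!lerBrDl => h A0P.
apply: (le_trans h); rewrite lerBlDr -lerBlDl.
by move/ltW: A0P.
Qed.

Lemma summable_cvg (H : completeNormedModType R[i]) (x : I -> H) (M : R[i]) :
  (forall A : {fset I}, \sum_(i <- A) `|x i| <= M) ->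
  cvg (summability.partial_sum x @ summability.totally).
Proof.
move=> xM; apply/cauchy_cvgP; apply: cauchy_exP => e e0.
have e20 : 0 < e / 2 by rewrite divr_gt0.
have [//|A0 A0P] := bounded_tail (a := fun i => `|x i|) _ xM e20.
exists (summability.partial_sum x A0); exists A0 => // B /= AB.
rewrite -ball_normE /=.
have psE (A : {fset I}) : summability.partial_sum x A = \sum_(i <- A) x i.
  by rewrite /summability.partial_sum big_seq_fsetE.
rewrite !psE (big_fset_sub _ AB) opprD addrA subrr add0r normrN.
apply: (le_lt_trans (ler_norm_sum _ _ _)).
apply: (@le_lt_trans _ _ (e / 2)).
  by apply: A0P => i; rewrite in_fsetD => /andP[].
by rewrite ltr_pdivrMr// ltr_pMr// ltr1n.
Qed.

End unordered_sums.

Section l2.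
Context (R : realType) (I : choiceType) (H : hilbertType R).

Definition square_summable (f : I -> H) : Prop :=
  exists M : R[i], forall A : {fset I}, \sum_(i <- A) `|f i| ^+ 2 <= M.

Definition square_summable_pred : {pred I -> H} := fun f => `[< square_summable f >].

Record l2 := L2 { l2_fun :> I -> H ; l2_subproof : l2_fun \in square_summable_pred }.

HB.instance Definition _ := [isSub for l2_fun].
HB.instance Definition _ := [Choice of l2 by <:].

Lemma parallelogram (u v : H) :
  `|u + v| ^+ 2 + `|u - v| ^+ 2 = 2 * (`|u| ^+ 2 + `|v| ^+ 2).
Proof.
rewrite !hnormE linearDl linearBl !linearDr !linearNr/=.
set a := hdot u u; set b := hdot v v; set c := hdot u v; set d := hdot v u.
by ring.
Qed.

Lemma sqr_normD (u v : H) : `|u + v| ^+ 2 <= 2 * (`|u| ^+ 2 + `|v| ^+ 2).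
Proof. by rewrite -parallelogram lerDl exprn_ge0. Qed.

Lemma square_summable_submod : submod_closed square_summable_pred.
Proof.
split=> [|a f g /asboolP[M fM] /asboolP[N gN]].
  by apply/asboolP; exists 0 => A; rewrite big1// => i _; rewrite normr0 expr0n.
apply/asboolP; exists (2 * (`|a| ^+ 2 * M + N)) => A.
apply: (@le_trans _ _ (\sum_(i <- A) 2 * (`|a| ^+ 2 * `|f i| ^+ 2 + `|g i| ^+ 2))).
  apply: ler_sum => i _; apply: le_trans (sqr_normD _ _) _.
  by rewrite normrZ exprMn.
rewrite -mulr_sumr ler_wpM2l// big_split/= lerD// -mulr_sumr.
by rewrite ler_wpM2l// exprn_ge0.
Qed.

HB.instance Definition _ := GRing.isSubmodClosed.Build R[i] (I -> H)
  square_summable_pred square_summable_submod.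
HB.instance Definition _ := [SubChoice_isSubLmodule of l2 by <:].

End l2.

Lemma scalars_normE (R : realType) (x : scalars R) : `|x| = `|x : R[i]| :> R[i].
Proof.
apply/eqP; rewrite -(eqrXn2 (n := 2))// hnormE scalars_dotE.
by rewrite normCK.
Qed.

Section l2_hilbert.
Context {R : realType} {I : choiceType} {H : hilbertType R}.
#[local] Existing Instance summability.totally_filter.
Implicit Types f g h : l2 I H.

Lemma l2P f : square_summable f.
Proof. by case: f => f /= /asboolP. Qed.

Lemma l2_lincE (a : R[i]) f g i : (a *: f + g) i = a *: f i + g i.
Proof. by []. Qed.

Lemma l2_subE f g i : (f - g) i = f i - g i.
Proof. by []. Qed.

(* The inner product is an unordered sum: the limit of the partial sums along
   the finite subsets of I ordered by inclusion. *)
Definition l2_terms f g : I -> scalars R := fun i => hdot (f i) (g i).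
Definition l2_dot f g : R[i] := summability.sum (l2_terms f g).

Lemma hdot_le (u v : H) : `|hdot u v| <= `|u| ^+ 2 + `|v| ^+ 2 :> R[i].
Proof.
have [->|d0] := eqVneq (hdot u v) 0.
  by rewrite normr0 addr_ge0// exprn_ge0.
pose a : R[i] := hdot u v / `|hdot u v|.
have n0 : `|hdot u v| != 0 by rewrite normr_eq0.
have a1 : `|a| = 1 by rewrite normrM normfV normr_id divff.
have : 0 <= `|u - a *: v| ^+ 2 by rewrite exprn_ge0.
rewrite (hnormE (u - _)) dnormB/= -!hnormE normrZ a1 mul1r.
have -> : hdot u (a *: v) = `|hdot u v|.
  rewrite linearZr_LR/= /a rmorphM/= fmorphV/= (CrealP (normr_real _)).
  by rewrite mulrAC -normCKC expr2 mulfK.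
rewrite (CrealP (normr_real _)) subr_ge0; apply: le_trans.
by rewrite lerDl.
Qed.

Lemma l2_dot_cvg f g :
  summability.partial_sum (l2_terms f g) @ summability.totally --> (l2_dot f g : scalars R).
Proof.
have [M fM] := l2P f; have [N gN] := l2P g.
apply: (@summable_cvg _ _ _ _ (M + N)) => A.
apply: (@le_trans _ _ (\sum_(i <- A) (`|f i| ^+ 2 + `|g i| ^+ 2))).
  by apply: ler_sum => i _; rewrite scalars_normE hdot_le.
by rewrite big_split/= lerD.
Qed.

Lemma l2_dot_lim f g (l : scalars R) :
  summability.partial_sum (l2_terms f g) @ summability.totally --> l -> l2_dot f g = l.
Proof. by move=> fgl; apply: cvg_lim fgl; exact: norm_hausdorff. Qed.

Lemma l2_partialE f g (A : {fset I}) :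
  summability.partial_sum (l2_terms f g) A = \sum_(i <- A) (hdot (f i) (g i) : scalars R).
Proof. by rewrite /summability.partial_sum big_seq_fsetE. Qed.

Lemma l2_dot_approx f g (A0 : {fset I}) (e : R[i]) : 0 < e ->
  exists2 A : {fset I}, (A0 `<=` A)%fset &
    `|l2_dot f g - \sum_(i <- A) hdot (f i) (g i)| <= e.
Proof.
move=> e0; have /cvgrPdist_le /(_ e e0)[A1 _ A1P] := @l2_dot_cvg f g.
exists (A0 `|` A1)%fset; first exact: fsubsetUl.
have := A1P (A0 `|` A1)%fset (fsubsetUr _ _).
by rewrite l2_partialE scalars_normE.
Qed.

Lemma l2_term_le f i : `|f i| ^+ 2 <= l2_dot f f.
Proof.
apply: lec_approx => e e0; have [A iA fA] := @l2_dot_approx f f [fset i]%fset _ e0.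
exists (\sum_(i <- A) hdot (f i) (f i)) => //.
rewrite (big_fset_sub _ iA) big_seq_fset1 hnormE lerDl.
by apply: sumr_ge0 => j _; exact: dnorm_ge0.
Qed.

Lemma l2_dot_le f (M : R[i]) : (forall A : {fset I}, \sum_(i <- A) `|f i| ^+ 2 <= M) ->
  l2_dot f f <= M.
Proof.
move=> fM; apply: gec_approx => e e0.
have [A iA fA] := @l2_dot_approx f f fset0 _ e0.
exists (\sum_(i <- A) hdot (f i) (f i)) => //.
by under eq_bigr do rewrite -hnormE.
Qed.

Lemma l2_sum_le f (A : {fset I}) : \sum_(i <- A) `|f i| ^+ 2 <= l2_dot f f.
Proof.
apply: lec_approx => e e0; have [B AB fB] := @l2_dot_approx f f A _ e0.
exists (\sum_(i <- B) hdot (f i) (f i)) => //.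
rewrite (big_fset_sub _ AB); under eq_bigr do rewrite hnormE.
by rewrite lerDl; apply: sumr_ge0 => j _; exact: dnorm_ge0.
Qed.

Let dotP (a : R[i]) f g h : l2_dot (a *: f + g) h = a * l2_dot f h + l2_dot g h.
Proof.
apply: l2_dot_lim.
rewrite (_ : summability.partial_sum _ =
   fun A => a *: summability.partial_sum (l2_terms f h) A +
            summability.partial_sum (l2_terms g h) A); last first.
  apply/funext => A; rewrite !l2_partialE scaler_sumr -big_split/=.
  by apply: eq_bigr => i _; rewrite /l2_terms -hdotP.
by apply: cvgD; [apply: cvgZl_tmp; exact: l2_dot_cvg|exact: l2_dot_cvg].
Qed.

Let dotC f g : l2_dot f g = Num.conj (l2_dot g f).
Proof.
apply: l2_dot_lim; apply/cvgrPdist_le => e e0.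
have /cvgrPdist_le /(_ e e0) := @l2_dot_cvg g f; apply: filterS => A.
rewrite !scalars_normE !l2_partialE; set s := l2_dot g f - _.
rewrite -norm_conjC; congr (`|_| <= _).
rewrite /s rmorphB/=; congr (_ - _); rewrite rmorph_sum/=.
by apply: eq_bigr => i _; rewrite -hdotC.
Qed.

Let dot_gt0 f : f != 0 -> 0 < l2_dot f f.
Proof.
move=> f0; have [i fi0] : exists i, f i != 0.
  apply/not_existsP => fi; move/eqP: f0; apply; apply/val_inj/funext => i /=.
  by apply/eqP; have /negP := fi i; rewrite negbK.
by apply: lt_le_trans (l2_term_le f i); rewrite exprn_gt0// normr_gt0.
Qed.

Let dot_complete (u : nat -> l2 I H) :
  dot_cauchy l2_dot u -> exists l, dot_cvg l2_dot u l.
Proof.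
move=> uc.
have /choice[l lP] : forall i, exists l, dot_cvg (@hdot R H) (fun n => u n i) l.
  move=> i; apply: hdot_complete => e /uc[N NP]; exists N => m n Nm Nn.
  by apply: le_trans (NP m n Nm Nn); rewrite -hnormE -l2_subE; exact: l2_term_le.
have key e : 0 < e -> exists N : nat, forall n, (N <= n)%N -> forall A : {fset I},
    \sum_(i <- A) `|u n i - l i| ^+ 2 <= e.
  move=> e0; have e40 : 0 < e / 2 / 2 by rewrite !divr_gt0.
  have [N NP] := uc _ e40; exists N => n Nn A.
  have e5 : 0 < e / 2 / 2 / (size A).+1%:R by rewrite divr_gt0.
  have /choice[K KP] := fun i => lP i _ e5.
  pose m := maxn N (\max_(i <- A) K i)%N.
  apply: (@le_trans _ _
    (\sum_(i <- A) 2 * (`|u n i - u m i| ^+ 2 + `|u m i - l i| ^+ 2))).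
    apply: ler_sum => i _.
    by rewrite -[u n i - l i](subrKA (u m i)) sqr_normD.
  rewrite -mulr_sumr mulrC -ler_pdivlMr// big_split/= [leRHS]splitr lerD//.
    apply: le_trans (NP n m Nn (leq_maxl _ _)).
    by apply: le_trans (l2_sum_le _ A); apply: ler_sum => i _; rewrite l2_subE.
  apply: (@le_trans _ _ (\sum_(i <- A) (e / 2 / 2 / (size A).+1%:R))).
    rewrite big_seq [leRHS]big_seq; apply: ler_sum => i iA.
    rewrite hnormE KP// /m leq_max; apply/orP; right.
    exact: leq_bigmax_seq.
  rewrite big_const_seq count_predT iter_addr_0 -[leLHS]mulr_natr [leLHS]mulrAC ler_pdivrMr//.
  by rewrite ler_pM2l// ler_nat.
have [|N1 N1P] := key 1; first by [].
have dl : (fun i => u N1 i - l i) \in @square_summable_pred R I H.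
  by apply/asboolP; exists 1 => A; exact: N1P.
have ll : l \in @square_summable_pred R I H.
  have -> : l = (u N1 : I -> H) - (fun i => u N1 i - l i).
    by apply/funext => i /=; rewrite /GRing.add/= /GRing.opp/= subKr.
  by rewrite rpredB// l2_subproof.
exists (L2 ll) => e e0; have [N NP] := key e e0; exists N => n Nn.
by apply: l2_dot_le => A; exact: NP.
Qed.

HB.instance Definition _ := Lmodule_isHilbert.Build R (l2 I H)
  dotP dotC dot_gt0 dot_complete.

Lemma l2_dotE f g : hdot f g = l2_dot f g.
Proof. by []. Qed.

End l2_hilbert.

Record closed_subspace (R : realType) (H : hilbertType R) := ClosedSubspace {
  cs_pred : {pred H} ;
  cs_submod : submod_closed cs_pred ;
  cs_closed : closed [set x | x \in cs_pred]
}.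

Section subspace_hilbert.
Context (R : realType) (H : hilbertType R) (A : closed_subspace H).

HB.instance Definition _ :=
  GRing.isSubmodClosed.Build R[i] H (cs_pred A) (cs_submod A).

Record subspace_of := SubspaceOf {
  subspace_val :> H ; subspace_subproof : subspace_val \in cs_pred A }.

HB.instance Definition _ := [isSub for subspace_val].
HB.instance Definition _ := [Choice of subspace_of by <:].
HB.instance Definition _ := [SubChoice_isSubLmodule of subspace_of by <:].

Let dot (x y : subspace_of) : R[i] := hdot (x : H) (y : H).

Let dotP a u v w : dot (a *: u + v) w = a * dot u w + dot v w.
Proof. exact: hdotP. Qed.

Let dotC u v : dot u v = Num.conj (dot v u).
Proof. exact: hdotC. Qed.

Let dot_gt0 u : u != 0 -> 0 < dot u u.
Proof. by move=> u0; apply: hdot_gt0; apply: contraNN u0 => /eqP u0; apply/eqP/val_inj. Qed.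

Let dot_complete u : dot_cauchy dot u -> exists l, dot_cvg dot u l.
Proof.
move=> uc; have [l lP] := @hdot_complete R H (fun n => u n : H) uc.
have lA : l \in cs_pred A.
  apply: (@closed_cvg _ _ \oo _ (fun n => u n : H) _ (@cs_closed _ _ A)) => [|].
    by near=> n; exact: subspace_subproof.
  apply/cvgrPdist_le => e e0; have [|N NP] := lP (e ^+ 2); first by rewrite exprn_gt0.
  exists N => // n /= Nn; have := NP n Nn.
  by rewrite -hnormE ler_sqr ?nnegrE ?(ltW e0)// distrC.
by exists (SubspaceOf lA) => e e0; have [N NP] := lP e e0; exists N.
Unshelve. all: by end_near. Qed.

HB.instance Definition _ := Lmodule_isHilbert.Build R subspace_of
  dotP dotC dot_gt0 dot_complete.

Lemma subspace_dotE (x y : subspace_of) : hdot x y = hdot (x : H) (y : H).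
Proof. by []. Qed.

End subspace_hilbert.

#[short(type="boundedOp")]
HB.structure Definition BoundedOp (R : realType) (H K : hilbertType R) :=
  {f of @GRing.Linear R[i] H K *:%R f & @isContinuous H K f}.

Notation "{ 'bounded' H -> K }" := (boundedOp H%type K%type)
  (H at level 98, K at level 99, format "{ 'bounded'  H  ->  K }") : type_scope.

HB.instance Definition _ (R : realType) (H K : hilbertType R) :=
  gen_eqMixin {bounded H -> K}.
HB.instance Definition _ (R : realType) (H K : hilbertType R) :=
  gen_choiceMixin {bounded H -> K}.

Lemma lipschitz_linear_continuous (R : realType) (H K : hilbertType R)
    (f : {linear H -> K}) (M : R[i]) :
  (forall x, `|f x| <= M * `|x|) -> continuous f.
Proof.
move=> fM; apply/linear_bounded_continuous/linear_boundedP.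
exists `|M|; split => // r Mr x; have fx := fM x.
have Mx : 0 <= M * `|x| by exact: le_trans fx.
rewrite (le_trans fx)// -(ger0_norm Mx) normrM normr_id ler_wpM2r//.
exact: ltW.
Qed.

Section bounded_operators.
Context {R : realType}.
Implicit Types H K L : hilbertType R.

HB.instance Definition _ H K :=
  isContinuous.Build H K (\0 : H -> K) (@cst_continuous H K 0).

Definition null_op {H K} : {bounded H -> K} := \0.

Lemma idfun_continuous H : continuous (@idfun H).
Proof. by move=> x; exact: cvg_id. Qed.

HB.instance Definition _ H := isContinuous.Build H H idfun (@idfun_continuous H).

HB.instance Definition _ H K L (f : {bounded H -> K}) (g : {bounded K -> L}) :=
  isContinuous.Build H L (g \o f)
    (fun x => continuous_comp (@cts_fun _ _ f x) (@cts_fun _ _ g (f x))).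

Definition hinl H K (x : H) : hsum H K := (x, 0).
Definition hinr H K (y : K) : hsum H K := (0, y).
Definition hfst H K (x : hsum H K) : H := x.1.
Definition hsnd H K (x : hsum H K) : K := x.2.

Lemma hinl_linear H K : linear (@hinl H K).
Proof. by move=> a x y; congr pair; rewrite /= scaler0 addr0. Qed.
Lemma hinr_linear H K : linear (@hinr H K).
Proof. by move=> a x y; congr pair; rewrite /= scaler0 addr0. Qed.
Lemma hfst_linear H K : linear (@hfst H K). Proof. by []. Qed.
Lemma hsnd_linear H K : linear (@hsnd H K). Proof. by []. Qed.

HB.instance Definition _ H K := GRing.isLinear.Build _ _ _ _ (@hinl H K) (@hinl_linear H K).
HB.instance Definition _ H K := GRing.isLinear.Build _ _ _ _ (@hinr H K) (@hinr_linear H K).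
HB.instance Definition _ H K := GRing.isLinear.Build _ _ _ _ (@hfst H K) (@hfst_linear H K).
HB.instance Definition _ H K := GRing.isLinear.Build _ _ _ _ (@hsnd H K) (@hsnd_linear H K).

Lemma hinl_continuous H K : continuous (@hinl H K).
Proof.
apply: (@lipschitz_linear_continuous _ _ _ _ 1) => x.
rewrite mul1r -ler_sqr ?nnegrE// !hnormE hsum_dotE/= linear0r addr0//.
Qed.
Lemma hinr_continuous H K : continuous (@hinr H K).
Proof.
apply: (@lipschitz_linear_continuous _ _ _ _ 1) => x.
rewrite mul1r -ler_sqr ?nnegrE// !hnormE hsum_dotE/= linear0r add0r//.
Qed.
Lemma hfst_continuous H K : continuous (@hfst H K).
Proof.
apply: (@lipschitz_linear_continuous _ _ _ _ 1) => x.
by rewrite mul1r -ler_sqr ?nnegrE// !hnormE hsum_dotE lerDl dnorm_ge0.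
Qed.
Lemma hsnd_continuous H K : continuous (@hsnd H K).
Proof.
apply: (@lipschitz_linear_continuous _ _ _ _ 1) => x.
by rewrite mul1r -ler_sqr ?nnegrE// !hnormE hsum_dotE lerDr dnorm_ge0.
Qed.

HB.instance Definition _ H K := isContinuous.Build _ _ (@hinl H K) (@hinl_continuous H K).
HB.instance Definition _ H K := isContinuous.Build _ _ (@hinr H K) (@hinr_continuous H K).
HB.instance Definition _ H K := isContinuous.Build _ _ (@hfst H K) (@hfst_continuous H K).
HB.instance Definition _ H K := isContinuous.Build _ _ (@hsnd H K) (@hsnd_continuous H K).

Definition row_op d H K (T : 'I_d -> {bounded H -> K}) (x : hpow d H) : K :=
  \sum_(i < d) T i (x i).

Lemma row_op_linear d H K (T : 'I_d -> {bounded H -> K}) : linear (row_op T).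
Proof.
move=> a x y; rewrite /row_op scaler_sumr -big_split/=; apply: eq_bigr => i _.
by rewrite -linearP; congr (T i _); rewrite !ffunE.
Qed.

HB.instance Definition _ d H K (T : 'I_d -> {bounded H -> K}) :=
  GRing.isLinear.Build _ _ _ _ (row_op T) (row_op_linear T).

Lemma bounded_lipschitz H K (f : {bounded H -> K}) :
  exists2 M : R[i], 0 <= M & forall x, `|f x| <= M * `|x|.
Proof.
have /linear_bounded_continuous/linear_boundedP := @cts_fun _ _ f.
by move=> /pinfty_ex_gt0[M M0 fM]; exists M => //; exact: ltW.
Qed.

Lemma row_op_continuous d H K (T : 'I_d -> {bounded H -> K}) : continuous (row_op T).
Proof.
have /choice[M MP] : forall i, exists M : R[i], 0 <= M /\ forall x, `|T i x| <= M * `|x|.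
  by move=> i; have [M M0 TM] := bounded_lipschitz (T i); exists M.
apply: (@lipschitz_linear_continuous _ _ _ _ (\sum_(i < d) M i)) => x.
rewrite /row_op (le_trans (ler_norm_sum _ _ _))// mulr_suml ler_sum// => i _.
have [M0 TM] := MP i; rewrite (le_trans (TM _))// ler_wpM2l//.
rewrite -ler_sqr ?nnegrE// !hnormE hpow_dotE (bigD1 i)//= lerDl sumr_ge0// => j _.
exact: dnorm_ge0.
Qed.

HB.instance Definition _ d H K (T : 'I_d -> {bounded H -> K}) :=
  isContinuous.Build _ _ (row_op T) (@row_op_continuous d H K T).

Definition hinj d H (j : 'I_d) (x : H) : hpow d H :=
  [ffun k => if k == j then x else 0].

Definition op_le H (S T : H -> H) : Prop := forall x, 0 <= hdot (T x - S x) x.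

(* The adjoint and the positive square root are picked by their defining
   properties, which determine them uniquely; the default value null_op is only
   reached for a pos_sqrt of an operator that is not positive. *)
Definition adjoint H K (T : {bounded H -> K}) : {bounded K -> H} :=
  xget null_op
    [set S : {bounded K -> H} | forall x y, hdot (T x) y = hdot x (S y)].

Definition pos_sqrt H (P : H -> H) : {bounded H -> H} :=
  xget null_op
    [set Q : {bounded H -> H} | op_le null_op Q /\ forall x, Q (Q x) = P x].

Definition unitary H K (U : {bounded H -> K}) : Prop :=
  (forall x y, hdot (U x) (U y) = hdot x y) /\ (forall y, exists x, U x = y).

Definition contraction H K (T : {bounded H -> K}) : Prop := forall x, `|T x| <= `|x|.

Lemma closure_normP H (A : set H) (p : H) :
  closure A p <-> forall e : R[i], 0 < e -> exists2 q, A q & `|p - q| < e.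
Proof.
split=> [pA e e0|pA B /nbhs_ballP[e /= e0 eB]].
  have [q [Aq]] := pA _ (nbhsx_ballx p e e0).
  by rewrite -ball_normE/= => pq; exists q.
by have [q Aq pq] := pA e e0; exists q; split => //; apply: eB; rewrite -ball_normE.
Qed.

Lemma ran_closure_submod H K (T : {bounded H -> K}) :
  submod_closed (fun y : K => `[< closure (range T) y >]).
Proof.
split=> [|a u v /asboolP/closure_normP Tu /asboolP/closure_normP Tv].
  by apply/asboolP/subset_closure; exists 0 => //; rewrite linear0.
apply/asboolP/closure_normP => e e0.
have a0 : 0 < `|a| + 1 by rewrite ltr_wpDl.
have [|_ [x _ <-] xu] := Tu (e / 2 / (`|a| + 1)); first by rewrite !divr_gt0.
have [|_ [y _ <-] yv] := Tv (e / 2); first by rewrite divr_gt0.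
exists (T (a *: x + y)); first by exists (a *: x + y).
rewrite linearP opprD addrACA -scalerBr (le_lt_trans (ler_normD _ _))//.
rewrite [e]splitr ler_ltD// normrZ.
apply: (@le_trans _ _ ((`|a| + 1) * `|u - T x|)).
  by rewrite ler_wpM2r// lerDl.
by rewrite mulrC -ler_pdivlMr// ltW.
Qed.

Lemma ran_closure_closed H K (T : {bounded H -> K}) :
  closed [set y | y \in (fun y : K => `[< closure (range T) y >])].
Proof.
have -> : [set y | y \in (fun y : K => `[< closure (range T) y >])] = closure (range T).
  by apply/seteqP; split => y /asboolP.
exact: closed_closure.
Qed.

Definition ran_closure H K (T : {bounded H -> K}) : closed_subspace K :=
  ClosedSubspace (ran_closure_submod T) (@ran_closure_closed _ _ T).

Lemma mem_ran_closure H K (T : {bounded H -> K}) (x : H) :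
  T x \in cs_pred (ran_closure T).
Proof. by apply/asboolP/subset_closure; exists x. Qed.

Definition to_ran H K (T : {bounded H -> K}) (x : H) : subspace_of (ran_closure T) :=
  SubspaceOf (mem_ran_closure T x).

End bounded_operators.

Arguments hinl {R H} K x.
Arguments hinr {R} H {K} y.
Arguments hfst {R H K} x.
Arguments hsnd {R H K} x.

Section fock.
#[local] Existing Instance summability.totally_filter.
Context {R : realType} (d : nat).

(* The letters are 0, .., d-1 instead of 1, .., d. *)
Definition word : Type := seq 'I_d.
HB.instance Definition _ := Choice.on word.

(* The full Fock space over C^d, the Hilbert direct sum over n of the n-fold
   tensor powers of C^d, in the coordinates of its orthonormal basis
   e_alpha = e_{alpha_1} \otimes .. \otimes e_{alpha_n}; e_[::] is the vacuum. *)
Definition fock : hilbertType R := l2 word (scalars R).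

Lemma fock_basis_subproof (alpha : word) :
  (fun beta : word => (beta == alpha)%:R : scalars R)
    \in @square_summable_pred R word (scalars R).
Proof.
apply/asboolP; exists 1 => A.
have -> : \sum_(i <- A) `|((i == alpha)%:R : scalars R)| ^+ 2 =
    \sum_(i <- A | i == alpha) (1 : R[i]).
  rewrite [RHS]big_mkcond/=; apply: eq_bigr => i _.
  rewrite scalars_normE; case: eqP => _; first by rewrite normr1 expr1n.
  by rewrite normr0 expr0n.
rewrite big_const_seq iter_addr_0 -(eq_count (a1 := pred1 alpha))//.
by rewrite count_uniq_mem ?fset_uniq// -[leRHS]mulr1n ler_nat leq_b1.
Qed.

Definition fock_basis (alpha : word) : fock := L2 (fock_basis_subproof alpha).

(* The Hilbert space tensor product of the Fock space with H: xi \otimes h is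
   the family (xi_alpha h)_alpha. Elementary tensors multiply inner products
   (tensor_dot) and span a dense subspace (fock_basis_sum). *)
Definition fock_tensor (H : hilbertType R) : hilbertType R := l2 word H.

Lemma tensor_subproof (H : hilbertType R) (xi : fock) (h : H) :
  (fun alpha => (xi alpha : R[i]) *: h) \in @square_summable_pred R word H.
Proof.
have [M xiM] := l2P xi; apply/asboolP; exists (M * `|h| ^+ 2) => A.
under eq_bigr do rewrite normrZ exprMn.
rewrite -mulr_suml ler_wpM2r ?exprn_ge0//; apply: le_trans (xiM A).
by apply: ler_sum => i _; rewrite scalars_normE.
Qed.

Definition tensor (H : hilbertType R) (xi : fock) (h : H) : fock_tensor H :=
  L2 (tensor_subproof xi h).

Lemma tensor_dot (H : hilbertType R) (xi eta : fock) (h k : H) :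
  hdot (tensor xi h) (tensor eta k) = hdot xi eta * hdot h k.
Proof.
rewrite !l2_dotE; apply: l2_dot_lim.
rewrite (_ : summability.partial_sum _ =
   fun A => hdot h k *: summability.partial_sum (l2_terms xi eta) A); last first.
  apply/funext => A; rewrite !l2_partialE scaler_sumr/=; apply: eq_bigr => i _.
  rewrite scalars_dotE /l2_terms/= linearZl_LR linearZr_LR/=.
  by rewrite mulrA mulrC.
by rewrite mulrC; apply: cvgZl_tmp; exact: l2_dot_cvg.
Qed.

Lemma fock_basis_sum (H : hilbertType R) (f : fock_tensor H) :
  summability.partial_sum (fun alpha => tensor (fock_basis alpha) (f alpha))
    @ summability.totally --> f.
Proof.
apply/cvgrPdist_le => e e0.
have [M fM] := l2P f.
have e20 : 0 < e ^+ 2 by rewrite exprn_gt0.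
have [|A0 A0P] := bounded_tail (a := fun i => `|f i| ^+ 2) _ fM e20.
  by move=> i; rewrite exprn_ge0.
exists A0 => // A /= A0A.
rewrite -ler_sqr ?nnegrE ?(ltW e0)// hnormE.
have sumE i : (summability.partial_sum (fun alpha => tensor (fock_basis alpha) (f alpha)) A) i
    = if i \in A then f i else 0.
  rewrite /summability.partial_sum -(big_seq_fsetE _ _ xpredT
    (fun alpha => tensor (fock_basis alpha) (f alpha)))/=.
  rewrite (big_morph (fun g : fock_tensor H => g i) (id1 := 0) (op1 := +%R))//.
  case: ifPn => iA.
    rewrite (big_fsetD1 i)//= eqxx scale1r big1_seq ?addr0// => j.
    rewrite in_fsetD1 => /andP[_ /andP[ji _]].
    by rewrite eq_sym (negPf ji) scale0r.
  rewrite big1_seq// => j /andP[_ jA] /=; case: eqP => [ij|_]; last by rewrite scale0r.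
  by move: iA; rewrite ij jA.
apply: l2_dot_le => B.
rewrite (eq_bigr (fun i => if i \in A then 0 else `|f i| ^+ 2)); last first.
  move=> i _; rewrite l2_subE sumE; case: ifP => _; last by rewrite subr0.
  by rewrite subrr normr0 expr0n.
rewrite (eq_bigr (fun i => if i \notin A then `|f i| ^+ 2 else 0)); last first.
  by move=> i _; case: ifP.
rewrite -big_mkcond -big_filter.
have -> : \sum_(i <- [seq i <- B | i \notin A]) `|f i| ^+ 2 =
    \sum_(i <- (B `\` A)%fset) `|f i| ^+ 2.
  apply: perm_big; apply: uniq_perm; rewrite ?filter_uniq ?fset_uniq// => i.
  by rewrite mem_filter in_fsetD.
apply: A0P => i; rewrite in_fsetD => /andP[iA _]; apply: contraNN iA.
exact: (fsubsetP A0A).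
Qed.

End fock.

Section liftings.
Context {R : realType} {d : nat}.
Implicit Types H HC HA : hilbertType R.

Definition row_contraction H (T : 'I_d -> {bounded H -> H}) : Prop :=
  op_le (fun h => \sum_(i < d) T i (adjoint (T i) h)) idfun.

Definition defect H (T : 'I_d -> {bounded H -> H}) : {bounded hpow d H -> hpow d H} :=
  pos_sqrt (fun x => x - adjoint (row_op T) (row_op T x)).

Definition defect_star H (T : 'I_d -> {bounded H -> H}) : {bounded H -> H} :=
  pos_sqrt (fun h => h - row_op T (adjoint (row_op T) h)).

Definition defect_space H (T : 'I_d -> {bounded H -> H}) : closed_subspace (hpow d H) :=
  ran_closure (defect T).

Definition defect_star_space H (T : 'I_d -> {bounded H -> H}) : closed_subspace H :=
  ran_closure (defect_star T).

Fixpoint op_word H (T : 'I_d -> {bounded H -> H}) (alpha : word d) :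
    {bounded H -> H} :=
  if alpha is i :: beta then T i \o op_word T beta else idfun.

Definition linear_span H (S : set H) : set H :=
  [set v | exists (n : nat) (a : 'I_n -> R[i]) (s : 'I_n -> H),
     (forall i, S (s i)) /\ v = \sum_(i < n) a i *: s i].

Definition contractive_lifting HC HA (C : 'I_d -> {bounded HC -> HC})
    (E : 'I_d -> {bounded hsum HC HA -> hsum HC HA}) : Prop :=
  row_contraction E /\
  exists (B : 'I_d -> {bounded HC -> HA}) (A : 'I_d -> {bounded HA -> HA}),
    forall i (x : hsum HC HA), E i x = (C i x.1, B i x.1 + A i x.2) :> hsum HC HA.

Definition minimal_lifting HC HA
    (E : 'I_d -> {bounded hsum HC HA -> hsum HC HA}) : Prop :=
  closure (linear_span
    [set op_word E alpha (hinl HA x) | alpha in [set: word d] & x in [set: HC]])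
  = [set: hsum HC HA].

(* The entries B_i and A_i of the block matrix of E_i. *)
Definition lifting_B HC HA (E : 'I_d -> {bounded hsum HC HA -> hsum HC HA})
    (i : 'I_d) : {bounded HC -> HA} := hsnd \o (E i \o hinl HA).

Definition lifting_A HC HA (E : 'I_d -> {bounded hsum HC HA -> hsum HC HA})
    (i : 'I_d) : {bounded HA -> HA} := hsnd \o (E i \o hinr HC).

Lemma contractive_lifting_blocks HC HA (C : 'I_d -> {bounded HC -> HC})
    (E : 'I_d -> {bounded hsum HC HA -> hsum HC HA}) :
  contractive_lifting C E -> forall i (x : hsum HC HA),
  E i x = (C i x.1, lifting_B E i x.1 + lifting_A E i x.2) :> hsum HC HA.
Proof.
move=> [_ [B [A EE]]] i x; rewrite /lifting_B /lifting_A /= !EE /hsnd/=.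
by rewrite !linear0 addr0 add0r.
Qed.

(* The unique contraction gamma : D_{*,A} -> D_C with B^* = D_C gamma D_{*,A}. *)
Definition lifting_gamma HC HA (C : 'I_d -> {bounded HC -> HC})
    (E : 'I_d -> {bounded hsum HC HA -> hsum HC HA}) :
    {bounded subspace_of (defect_star_space (lifting_A E)) -> subspace_of (defect_space C)} :=
  xget null_op [set g : {bounded subspace_of (defect_star_space (lifting_A E)) -> subspace_of (defect_space C)} |
    contraction g /\
    forall h : HA, adjoint (row_op (lifting_B E)) h =
      defect C (subspace_val (g (to_ran (defect_star (lifting_A E)) h)))].

(* The letter e_k in front of a sum of e_alpha \otimes x_alpha is absorbed in
   the terms, e_k \otimes e_alpha being e_(k :: alpha). The vector A D_A iota_j h
   equals D_{*,A} A iota_j h, hence lies in D_{*,A}; insubd regards it as an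
   element of that subspace. *)
Definition is_symbol HC HA (C : 'I_d -> {bounded HC -> HC})
    (E : 'I_d -> {bounded hsum HC HA -> hsum HC HA})
    (theta : {bounded subspace_of (defect_space E) -> fock_tensor d (subspace_of (defect_space C))}) : Prop :=
  let A := lifting_A E in let B := lifting_B E in
  let gamma := lifting_gamma C E in
  let e (alpha : word d) := tensor (fock_basis alpha) in
  (forall j (hc : HC),
     theta (to_ran (defect E) (hinj j (hinl HA hc))) =
       e [::] (to_ran (defect C) (hinj j hc)
               - gamma (to_ran (defect_star A) (B j hc)))
       - summability.sum (fun alpha : word d => if (1 <= size alpha)%N then
           e alpha (gamma (to_ran (defect_star A)
                             (adjoint (op_word A alpha) (B j hc))))
         else 0)) /\
  (forall j (ha : HA),
     theta (to_ran (defect E) (hinj j (hinr HC ha))) =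
       - e [::] (gamma (insubd 0 (row_op A (defect A (hinj j ha)))))
       + \sum_(k < d) summability.sum (fun alpha : word d =>
           e (k :: alpha) (gamma (to_ran (defect_star A)
             (adjoint (op_word A alpha)
               ((defect A (defect A (hinj j ha)) : hpow d HA) k)))))).

(* The operator theta_{C,E} determined by the two formulas, which prescribe it
   on a dense subspace of D_E. *)
Definition symbol HC HA (C : 'I_d -> {bounded HC -> HC})
    (E : 'I_d -> {bounded hsum HC HA -> hsum HC HA}) :
    {bounded subspace_of (defect_space E) -> fock_tensor d (subspace_of (defect_space C))} :=
  xget null_op [set theta | is_symbol theta].

Definition lifting_equiv HC HA HA'
    (E : 'I_d -> {bounded hsum HC HA -> hsum HC HA})
    (E' : 'I_d -> {bounded hsum HC HA' -> hsum HC HA'}) : Prop :=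
  exists2 U : {bounded HA -> HA'}, unitary U &
    forall i (x : hsum HC HA),
      ((E i x).1, U (E i x).2) = E' i (x.1, U x.2) :> hsum HC HA'.

Definition symbol_equiv H H1 H2 (theta1 : {bounded H1 -> fock_tensor d H})
    (theta2 : {bounded H2 -> fock_tensor d H}) : Prop :=
  exists2 v : {bounded H1 -> H2}, unitary v & forall x, theta1 x = theta2 (v x).

End liftings.

(* Main.v *)
(* Write D_E, D_C, D_{*,A} for the defect operators, gamma for the contraction with
   B^* = D_C gamma D_{*,A}, and kernel h = gamma D_{*,A} h. Evaluated at D_E x, with
   y the second component of E x, the symbol theta has the coordinates
     D_C x_C - kernel y                        at the empty word,
     kernel (A_w^* ((x_A)_j - A_j^* y))        at the word j w,
   and a direct computation bounds their square sum by |D_E x|^2, so theta exists.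
   A unitary U intertwining E and E' preserves all these quantities, hence
   D_E x |-> D_{E'} (1 + U) x is a unitary v with theta = theta' v.

   Conversely, theta^* (e_w \otimes D_C g) = D_E y(w, g), where y(w, g) is g for the
   empty word and A_v B g in the j-th copy of H_A for w = j v; moreover E y(w, g) has
   second component A_w B g. If theta = theta' v then v D_E y(w, g) = D_{E'} y'(w, g), so
   <y1, y2> - <E y1, E y2> takes the same values for E and E'. This expresses the
   inner products of the vectors A_w B g through those for shorter words, so by
   induction they agree for E and E'. By minimality these vectors span dense subspaces
   of H_A and H_A', and A_w B g |-> A'_w B' g extends to the required unitary. *)
From HB Require Import structures.
From mathcomp Require Import all_boot all_order all_algebra.
From mathcomp Require Import finmap.
From mathcomp Require Import all_classical all_reals all_analysis.
From mathcomp Require Import sesquilinear complex ring lra.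
From mathcomp.analysis.showcase Require summability.
Require Import Defs.

Set Implicit Arguments.
Unset Strict Implicit.
Unset Printing Implicit Defensive.

Import Order.TTheory GRing.Theory Num.Theory.
Import numFieldNormedType.Exports.

Local Open Scope classical_set_scope.
Local Open Scope ring_scope.
Local Open Scope complex_scope.

(** * Extension of densely defined contractions *)

Section hilbert_space.
Context {R : realType}.
Implicit Types H K L : hilbertType R.

Lemma cauchy_schwarz H (u v : H) : `|hdot u v| <= `|u| * `|v| :> R[i].
Proof.
have [->|v0] := eqVneq v 0; first by rewrite linear0r !normr0 mulr0.
have vv0 : 0 < hdot v v by exact: hdot_gt0.
rewrite -ler_sqr ?nnegrE ?mulr_ge0// exprMn !hnormE.
pose a := hdot u v / hdot v v.
have : 0 <= hdot (u - a *: v) (u - a *: v) by exact: dnorm_ge0.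
rewrite linearBl !linearBr/= !linearZl_LR !linearZr_LR/=.
have -> : Num.conj a = Num.conj (hdot u v) / hdot v v.
  by rewrite /a rmorphM/= fmorphV/= -(hdotC v v).
rewrite [hdot v u]hdotC normCK -(pmulr_rge0 _ vv0) -[X in _ -> is_true X]subr_ge0.
by congr (0 <= _); rewrite /a; field; rewrite gt_eqF.
Qed.

Lemma Re_cauchy_schwarz H (u v : H) :
  complex.Re (hdot u v) ^+ 2 <= complex.Re (hdot u u) * complex.Re (hdot v v).
Proof.
have E (w : H) : hdot w w = (complex.Re (hdot w w))%:C.
  by rewrite RRe_real// ger0_real// dnorm_ge0.
have := cauchy_schwarz u v.
rewrite -ler_sqr ?nnegrE ?mulr_ge0// exprMn !hnormE E [hdot v v]E -rmorphM/=.
move=> h; rewrite -lecR; apply: le_trans h.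
rewrite -[X in X%:C]real_normK ?num_real// rmorphXn/= ler_sqr ?nnegrE//.
  exact: normc_ge_Re.
by rewrite lecR.
Qed.

Lemma hdot_eqP H (u v : H) : (forall w, hdot w u = hdot w v) -> u = v.
Proof.
move=> uv; apply/eqP; rewrite -subr_eq0 -(dnorm_eq0 (@hdot R H)) linearBr/=.
by rewrite uv subrr.
Qed.

Lemma hnorm_cauchy_cvg H (u : nat -> H) :
  (forall e : R[i], 0 < e -> exists N : nat, forall m n,
     (N <= m)%N -> (N <= n)%N -> `|u m - u n| <= e) ->
  exists l, forall e : R[i], 0 < e -> exists N : nat, forall n,
     (N <= n)%N -> `|u n - l| <= e.
Proof.
move=> uc; have [|l lP] := @hdot_complete R H u.
  move=> e e0; have [|N NP] := uc (sqrtC e); first by rewrite sqrtC_gt0.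
  exists N => m n Nm Nn; rewrite -hnormE -[leRHS]sqrtCK.
  by rewrite ler_sqr ?nnegrE ?sqrtC_ge0 ?(ltW e0)// NP.
exists l => e e0; have [|N NP] := lP (e ^+ 2); first by rewrite exprn_gt0.
by exists N => n /NP; rewrite -hnormE ler_sqr ?nnegrE ?(ltW e0).
Qed.

(** Operators built below come from pointwise choice as bare functions; this equips such a function
    with its bundled structure. *)
Lemma bounded_of H K (f : H -> K) (M : R[i]) : linear f ->
  (forall x, `|f x| <= M * `|x|) -> exists F : {bounded H -> K}, F =1 f.
Proof.
move=> lf fM.
pose lm := GRing.isLinear.Build R[i] H K *:%R f lf.
pose fl : {linear H -> K} := HB.pack f lm.
have fc : continuous fl by exact: (@lipschitz_linear_continuous _ _ _ fl M).
pose cm := isContinuous.Build H K f fc.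
pose F : {bounded H -> K} := HB.pack f lm cm.
by exists F.
Qed.

(* The closure of the relation is again contractive, and everywhere defined. *)
Lemma contraction_extension H K (G : H -> K -> Prop) :
  (forall (a : R[i]) x y x' y', G x y -> G x' y' -> G (a *: x + x') (a *: y + y')) ->
  (forall x y, G x y -> `|y| <= `|x| :> R[i]) ->
  (forall h (e : R[i]), 0 < e -> exists x y, G x y /\ `|h - x| <= e) ->
  exists U : {bounded H -> K}, contraction U /\ forall x y, G x y -> U x = y.
Proof.
move=> Glin Gctr Gdense.
pose P h k := forall e : R[i], 0 < e ->
  exists x y, [/\ G x y, `|h - x| <= e & `|k - y| <= e].
have e20 (e : R[i]) : 0 < e -> 0 < e / 2 by move=> e0; rewrite divr_gt0.
have Pctr h k : P h k -> `|k| <= `|h|.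
  move=> hk; apply/ler_addgt0Pr => e /e20/hk[x [y [Gxy hx ky]]].
  rewrite -(subrK y k) (le_trans (ler_normD _ _))// addrC.
  rewrite [e]splitr addrA lerD// (le_trans (Gctr _ _ Gxy))//.
  rewrite -(subrK h x) (le_trans (ler_normD _ _))// addrC lerD//.
  by rewrite distrC.
have Plin (a : R[i]) h k h' k' : P h k -> P h' k' -> P (a *: h + h') (a *: k + k').
  move=> hk hk' e e0; have a0 : 0 < `|a| + 1 by rewrite ltr_wpDl.
  have [|x [y [Gxy hx ky]]] := hk (e / 2 / (`|a| + 1)); first by rewrite divr_gt0// e20.
  have [|x' [y' [Gxy' hx' ky']]] := hk' (e / 2); first exact: e20.
  have aux V (u u' v v' : (V : hilbertType R)) : `|u - v| <= e / 2 / (`|a| + 1) ->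
      `|u' - v'| <= e / 2 -> `|a *: u + u' - (a *: v + v')| <= e.
    move=> uv uv'; rewrite opprD addrACA -scalerBr (le_trans (ler_normD _ _))//.
    rewrite [e]splitr lerD// normrZ mulrC.
    apply: le_trans (ler_wpM2r (normr_ge0 a) uv) _.
    by rewrite mulrAC ler_pdivrMr// ler_wpM2l ?(ltW (e20 _ _))// lerDl.
  by exists (a *: x + x'), (a *: y + y'); split; [exact: Glin|exact: aux|exact: aux].
have G0 x y : G x y -> P x y.
  by move=> Gxy e e0; exists x, y; rewrite !subrr !normr0 (ltW e0).
have /choice[U UP] : forall h, exists k, P h k.
  move=> h.
  have /choice[xy xyP] : forall n : nat, exists p : H * K,
      G p.1 p.2 /\ `|h - p.1| <= n.+1%:R^-1.
    move=> n; have [|x [y [Gxy hx]]] := Gdense h (n.+1%:R^-1); first by rewrite invr_gt0.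
    by exists (x, y).
  (* The second components are Cauchy: [G] contains differences of its pairs and is contractive, and
     the first components converge to [h]. *)
  have [|l lP] := @hnorm_cauchy_cvg K (fun n => (xy n).2).
    move=> e /e20/invSn_small[N NP]; exists N => m n Nm Nn.
    have [Gm hm] := xyP m; have [Gn hn] := xyP n.
    have := Glin (-1) _ _ _ _ Gn Gm; rewrite !scaleN1r => /Gctr.
    rewrite addrC => /le_trans; apply; rewrite addrC.
    rewrite -(subrKA h) (le_trans (ler_normD _ _))// [e]splitr lerD//.
      by rewrite distrC (le_trans hm)// NP.
    by rewrite (le_trans hn)// NP.
  exists l => e e0; have [N1 N1P] := invSn_small e0; have [N2 N2P] := lP e e0.
  pose n := maxn N1 N2; exists (xy n).1, (xy n).2; have [Gn hn] := xyP n; split => //.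
    by rewrite (le_trans hn)// N1P// leq_maxl.
  by rewrite distrC N2P// leq_maxr.
have Puniq h k k' : P h k -> P h k' -> k = k'.
  move=> hk hk'; have := Plin (-1) _ _ _ _ hk hk'; rewrite !scaleN1r addNr => /Pctr.
  by rewrite normr0 normr_le0 addrC subr_eq0 => /eqP.
have [|x|F FU] := @bounded_of H K U 1.
- by move=> a u v; apply: (Puniq (a *: u + v)); [exact: UP|exact: Plin].
- by rewrite mul1r; exact/Pctr/UP.
exists F; split=> [x|x y Gxy]; rewrite FU; first exact/Pctr/UP.
by apply: (Puniq x); [exact: UP|exact: G0].
Qed.

End hilbert_space.

(** * The Riesz representation theorem *)

Section riesz_representation.
Context {R : realType}.
Implicit Types H K L : hilbertType R.

Lemma hdotZl H (a : R[i]) (u v : H) : hdot (a *: u) v = a * hdot u v.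
Proof. exact: linearZl_LR. Qed.

Lemma hdotZr H (a : R[i]) (u v : H) : hdot u (a *: v) = Num.conj a * hdot u v.
Proof. exact: linearZr_LR. Qed.

Lemma hdotDl H (u v w : H) : hdot (u + v) w = hdot u w + hdot v w.
Proof. exact: linearDl. Qed.

Lemma hdotDr H (u v w : H) : hdot u (v + w) = hdot u v + hdot u w.
Proof. exact: linearDr. Qed.

Lemma hdotBl H (u v w : H) : hdot (u - v) w = hdot u w - hdot v w.
Proof. exact: linearBl. Qed.

Lemma hdotBr H (u v w : H) : hdot u (v - w) = hdot u v - hdot u w.
Proof. exact: linearBr. Qed.

Lemma hdot_suml H (I : Type) (r : seq I) (P : pred I) (f : I -> H) (v : H) :
  hdot (\sum_(i <- r | P i) f i) v = \sum_(i <- r | P i) hdot (f i) v.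
Proof.
by apply: (big_morph (fun u => hdot u v)) => [u w|]; [exact: hdotDl|exact: linear0l].
Qed.

Lemma Re_scale (t : R) (z : R[i]) : complex.Re (t%:C * z) = t * complex.Re z.
Proof. by case: z => a b /=; rewrite mul0r subr0. Qed.

Lemma Re_dotC H (u v : H) : complex.Re (hdot u v) = complex.Re (hdot v u).
Proof. by rewrite hdotC; case: (hdot v u). Qed.

Lemma hdot_ReE H (u : H) : hdot u u = (complex.Re (hdot u u))%:C.
Proof. by rewrite RRe_real// ger0_real// dnorm_ge0. Qed.

Lemma Re_dot_ge0 H (u : H) : 0 <= complex.Re (hdot u u).
Proof. by rewrite -lecR -hdot_ReE dnorm_ge0. Qed.

Lemma Re_dotDZ H (u v : H) (t : R) :
  complex.Re (hdot (u + t%:C *: v) (u + t%:C *: v)) =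
  complex.Re (hdot u u) + 2 * t * complex.Re (hdot v u) + t ^+ 2 * complex.Re (hdot v v).
Proof.
have ct : Num.conj t%:C = t%:C by exact: conjc_real.
rewrite linearDl !linearDr/= !hdotZl !hdotZr ct.
by rewrite !raddfD/= !Re_scale [complex.Re (hdot u v)]Re_dotC; ring.
Qed.

Lemma Re_dotD H (u v : H) : complex.Re (hdot (u + v) (u + v)) =
  complex.Re (hdot u u) + 2 * complex.Re (hdot v u) + complex.Re (hdot v v).
Proof.
rewrite linearDl !linearDr/= !raddfD/= [complex.Re (hdot u v)]Re_dotC.
by ring.
Qed.

Lemma Re_dotB H (u v : H) : complex.Re (hdot (u - v) (u - v)) =
  complex.Re (hdot u u) - 2 * complex.Re (hdot v u) + complex.Re (hdot v v).
Proof. by rewrite Re_dotD linearNl linearNr linearNl opprK raddfN/= mulrN. Qed.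

Section riesz.
Variables (H : hilbertType R) (phi : H -> R[i]) (c : R).
Hypothesis phiP : forall a u v, phi (a *: u + v) = a * phi u + phi v.
Hypothesis phi_bound : forall x, `|phi x| <= c%:C * `|x|.

(* The representing vector minimizes this functional. *)
Let F (x : H) : R := complex.Re (hdot x x) - 2 * complex.Re (phi x).

Let FDZ (x a : H) (t : R) :
  F (x + t%:C *: a) = F x + 2 * t * complex.Re (hdot a x - phi a)
    + t ^+ 2 * complex.Re (hdot a a).
Proof.
rewrite /F; have -> : phi (x + t%:C *: a) = t%:C * phi a + phi x by rewrite addrC phiP.
rewrite Re_dotDZ !raddfD/= raddfN/= Re_scale; ring.
Qed.

(** With r = |x|, F x >= r^2 - 2 c r = (r - c)^2 - c^2. *)
Let F_lbound (x : H) : - c ^+ 2 <= F x.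
Proof.
pose r := complex.Re `|x|.
have rE : `|x| = r%:C by rewrite /r RRe_real// ger0_real.
have xr : complex.Re (hdot x x) = r ^+ 2 by rewrite -hnormE rE -rmorphXn.
have := phi_bound x; rewrite rE -rmorphM/= => /(le_trans (normc_ge_Re _)).
rewrite lecR => /ler_normlW phir; rewrite /F xr.
have := sqr_ge0 (r - c); nra.
Qed.

Let I := inf (range F).

Let I_le x : I <= F x.
Proof.
apply: ge_inf; last by exists x.
by exists (- c ^+ 2) => _ [y _ <-]; exact: F_lbound.
Qed.

(** The parallelogram identity, combined with I <= F at the midpoint of x and y. It makes minimizing
    sequences Cauchy. *)
Let parallelogramF x y : complex.Re (hdot (x - y) (x - y)) <= 2 * (F x + F y - 2 * I).
Proof.
have := I_le (0 + (2^-1)%:C *: (x + y)).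
rewrite FDZ linear0r sub0r.
have -> : F 0 = 0.
  have phi0 : phi 0 = 0 by have := phiP (-1) 0 0; rewrite scaler0 addr0 mulN1r addNr.
  by rewrite /F linear0l phi0 raddf0 mulr0 subr0.
have -> : phi (x + y) = phi x + phi y by rewrite -[x]scale1r phiP mul1r scale1r.
rewrite /F Re_dotD Re_dotB raddfN raddfD/=.
lra.
Qed.

Let near_min (e : R) : 0 < e -> exists x, F x <= I + e.
Proof.
move=> e0; have [|_ [x _ <-] /ltW xe] := @inf_adherent _ (range F) e e0.
  split; first by exists (F 0), 0.
  by exists (- c ^+ 2) => _ [y _ <-]; exact: F_lbound.
by exists x.
Qed.

(** A minimizing sequence of [F] converges to some z, and the first variation of [F] at z vanishes
    in every direction a. It is estimated along the sequence, where almost-minimality bounds it. *)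
Lemma riesz : exists z, forall x, phi x = hdot x z.
Proof.
have /choice[u uP] : forall n : nat, exists x, F x <= I + n.+1%:R^-1.
  by move=> n; apply: near_min; rewrite invr_gt0.
have e40 (e : R) : 0 < e -> 0 < e / 4 by move=> e0; rewrite divr_gt0.
have nlt (e : R) : 0 < e -> exists N : nat, forall n, (N <= n)%N -> n.+1%:R^-1 <= e.
  move=> e0; have [|N NP] := @invSn_small R e%:C; first by rewrite ltcR.
  by exists N => n /NP; rewrite -lecR fmorphV/= rmorph_nat.
have [|z zP] := @hdot_complete R H u.
  move=> e e0; have er : e = (complex.Re e)%:C by rewrite RRe_real// gtr0_real.
  have /e40/nlt[N NP] : 0 < complex.Re e by rewrite -ltcR -er.
  exists N => m n Nm Nn; rewrite hdot_ReE er lecR.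
  apply: le_trans (parallelogramF _ _) _.
  have h k : (N <= k)%N -> F (u k) <= I + complex.Re e / 4.
    by move=> /NP Nk; rewrite (le_trans (uP k))// lerD2l.
  by have := h _ Nm; have := h _ Nn; lra.
exists z.
have Re0 a : complex.Re (hdot a z - phi a) = 0.
  apply/eqP; rewrite -sqrf_eq0 eq_le sqr_ge0 andbT.
  apply/ler_addgt0Pr => e e0; rewrite add0r.
  set N2 := complex.Re (hdot a a).
  have N20 : 0 <= N2 by exact: Re_dot_ge0.
  (* The target is (r - s)^2 <= 2 r^2 + 2 s^2, where both squares will be at most e' * N2 <= e / 4.
     The added 1 covers N2 = 0. *)
  pose e' := e / (4 * (N2 + 1)).
  have e'0 : 0 < e' by rewrite divr_gt0// mulr_gt0// ltr_wpDl.
  have [N1 N1P] := nlt _ e'0.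
  have [|N3 N3P] := zP e'%:C; first by rewrite ltcR.
  pose n := maxn N1 N3.
  have hn := N1P n (leq_maxl _ _); have un := uP n.
  have N_1 : n.+1%:R^-1 <= 1 :> R by rewrite invf_le1 ?ler1n// ltr0n.
  move: (n.+1%:R^-1) hn un N_1 => en hn un N_1.
  have := N3P n (leq_maxr _ _).
  rewrite hdot_ReE lecR => hz.
  have := Re_cauchy_schwarz a (u n - z).
  set w := complex.Re (hdot (u n - z) _) in hz *; rewrite -/N2 => hcs.
  pose r := complex.Re (hdot a (u n) - phi a).
  have hr : r ^+ 2 <= en * N2.
    have key t : - en <= 2 * t * r + t ^+ 2 * N2.
      have := I_le (u n + t%:C *: a); rewrite FDZ -/r -/N2.
      by move: un; lra.
    (* If N2 = 0 and r is nonzero, t = - 1 / r would force en >= 2, against en <= 1. Otherwise t = -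
       r / N2 minimizes the quadratic and gives r^2 / N2 <= en. *)
    have [N2_0|N2_neq0] := eqVneq N2 0.
      rewrite N2_0 mulr0; have [->|r0] := eqVneq r 0; first by rewrite expr0n.
      have := key (- r^-1); rewrite N2_0 mulr0 addr0 mulrN mulNr -mulrA mulVf// mulr1.
      by move: N_1; lra.
    have := key (- (r / N2)); rewrite sqrrN expr_div_n => h.
    have E : 2 * - (r / N2) * r + r ^+ 2 / N2 ^+ 2 * N2 = - (r ^+ 2 / N2) by field.
    by move: h; rewrite E lerN2 ler_pdivrMr// lt_def N2_neq0.
  have -> : complex.Re (hdot a z - phi a) = r - complex.Re (hdot a (u n - z)).
    by rewrite /r linearBr/= !raddfB/=; ring.
  set s := complex.Re (hdot a (u n - z)) in hcs *.
  have h4 : e' * N2 <= e / 4.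
    rewrite /e' invfM mulrA mulrAC ler_pdivrMr ?ltr_wpDl//.
    by rewrite ler_wpM2l ?(ltW (e40 _ _))// lerDl.
  have := ler_wpM2r N20 hn; have := ler_wpM2l N20 hz; have := sqr_ge0 (r + s).
  nra.
move=> x; apply/esym/eqP; rewrite -subr_eq0.
(* The real part at 'i x is minus the imaginary part at x. *)
have := Re0 ('i *: x); have := Re0 x.
have -> : phi ('i *: x) = 'i * phi x.
  have phi0 : phi 0 = 0 by have := phiP (-1) 0 0; rewrite scaler0 addr0 mulN1r addNr.
  by rewrite -[_ *: x]addr0 phiP phi0 addr0.
rewrite hdotZl -mulrBr mulrC ReiNIm; case: (hdot x z - phi x) => a b /= -> /eqP.
by rewrite oppr_eq0 => /eqP ->.
Qed.

End riesz.
End riesz_representation.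

(** * Adjoints, closed ranges and total families *)

Section operators.
Context {R : realType}.
Implicit Types H K L : hilbertType R.

(** Riesz represents x |-> <T x, y> by a vector S y. Testing at x = S y gives |S y|^2 <= |T (S y)|
    |y|, hence |S y| <= M |y|. *)
Lemma adjoint_exists H K (T : {bounded H -> K}) :
  exists S : {bounded K -> H}, forall x y, hdot (T x) y = hdot x (S y).
Proof.
have [M M0 TM] := bounded_lipschitz T.
have ME : M = (complex.Re M)%:C by rewrite RRe_real// ger0_real.
have /choice[S SP] : forall y, exists z, forall x, hdot (T x) y = hdot x z.
  move=> y; have yE : `|y| = (complex.Re `|y|)%:C by rewrite RRe_real// ger0_real.
  apply: (@riesz _ H (fun x => hdot (T x) y) (complex.Re M * complex.Re `|y|)).
    by move=> a u v; rewrite linearP linearDl/= hdotZl.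
  move=> x; rewrite (le_trans (cauchy_schwarz _ _))// rmorphM/= -ME -yE.
  by rewrite mulrAC ler_wpM2r.
have [||F FS] := @bounded_of _ K H S M.
- move=> a u v; apply: hdot_eqP => x.
  by rewrite -SP !linearDr/= !hdotZr -!SP.
- move=> y; have [->|y0] := eqVneq (S y) 0; first by rewrite normr0 mulr_ge0.
  have Sy0 : 0 < `|S y| by rewrite normr_gt0.
  rewrite -(ler_pM2l Sy0) -expr2 hnormE -SP -[leLHS]ger0_norm; last first.
    by rewrite SP dnorm_ge0.
  rewrite (le_trans (cauchy_schwarz _ _))// mulrA ler_wpM2r//.
  by rewrite mulrC TM.
by exists F => x y; rewrite FS.
Qed.

Lemma adjointP H K (T : {bounded H -> K}) x y : hdot (T x) y = hdot x (adjoint T y).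
Proof.
by have /(xgetPex null_op) := adjoint_exists T; exact.
Qed.

Lemma adjointPr H K (T : {bounded H -> K}) x y : hdot (adjoint T y) x = hdot y (T x).
Proof. by rewrite hdotC -adjointP -hdotC. Qed.

Lemma adjoint_eq H K (T : {bounded H -> K}) y z :
  (forall x, hdot (T x) y = hdot x z) -> adjoint T y = z.
Proof. by move=> h; apply: hdot_eqP => x; rewrite -adjointP h. Qed.

Lemma adjoint_contraction H K (T : {bounded H -> K}) :
  contraction T -> contraction (adjoint T).
Proof.
move=> cT y; have [->|y0] := eqVneq (adjoint T y) 0; first by rewrite normr0.
have y1 : 0 < `|adjoint T y| by rewrite normr_gt0.
rewrite -(ler_pM2l y1) -expr2 hnormE -adjointP -[leLHS]ger0_norm; last first.
  by rewrite adjointP dnorm_ge0.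
by rewrite (le_trans (cauchy_schwarz _ _))// ler_wpM2r.
Qed.

Lemma adjointK_contraction H K (T : {bounded H -> K}) :
  contraction (adjoint T) -> contraction T.
Proof.
move=> cT y; have [->|y0] := eqVneq (T y) 0; first by rewrite normr0.
have y1 : 0 < `|T y| by rewrite normr_gt0.
rewrite -(ler_pM2l y1) -expr2 hnormE adjointP -[leLHS]ger0_norm; last first.
  by rewrite -adjointP dnorm_ge0.
by rewrite (le_trans (cauchy_schwarz _ _))// mulrC ler_wpM2r.
Qed.

(** Expanding the form at x + a y for a = 1 and a = i gives two relations between <f x, y> and <f y,
    x> that force both to vanish; this is where complex scalars matter. *)
Lemma polarization0 H (f : {linear H -> H}) :
  (forall x, hdot (f x) x = 0) -> forall x, f x = 0.
Proof.
move=> f0 x; have sym a u v : Num.conj a * hdot (f u) v + a * hdot (f v) u = 0.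
  have := f0 (u + a *: v); rewrite linearD linearZ/= linearDl !linearDr/=.
  by rewrite !f0 hdotZl !hdotZr hdotZl f0 !mulr0 add0r addr0.
apply: hdot_eqP => y; rewrite linear0r hdotC.
have ci : Num.conj 'i%C = - 'i%C :> R[i].
  by apply/eqP; rewrite eq_complex/= oppr0 !eqxx.
have si := sym 'i%C x y; have s1 := sym 1 x y; rewrite ci in si.
rewrite rmorph1 !mul1r in s1; move/eqP: s1; rewrite addr_eq0 => /eqP s1.
move/eqP: si; rewrite s1 mulrNN -mulr2n mulrn_eq0/= mulf_eq0 => /orP[|/eqP ->].
  by rewrite eq_complex/= oner_eq0 andbF.
by rewrite oppr0 rmorph0.
Qed.

(** Positivity makes <Q z, z> real, so the quadratic form of Q minus its adjoint is zero and
    polarization applies. *)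
Lemma pos_hermitian H (Q : {bounded H -> H}) :
  op_le null_op Q -> forall x y, hdot (Q x) y = hdot x (Q y).
Proof.
move=> Q0 x y.
have Qr z : hdot (Q z) z = hdot z (Q z).
  by have := Q0 z; rewrite subr0 [RHS]hdotC => /ger0_real/CrealP ->.
rewrite adjointP; congr (hdot x _); apply/esym/eqP; rewrite -subr_eq0; apply/eqP.
apply: (@polarization0 H (Q \- adjoint Q)) => z /=.
by rewrite hdotBl adjointPr Qr subrr.
Qed.

Lemma ran_closure_dense H K (D : {bounded H -> K}) (h : subspace_of (ran_closure D))
    (e : R[i]) : 0 < e -> exists x, `|h - to_ran D x| <= e.
Proof.
move=> e0; have /asboolP/closure_normP/(_ e e0)[_ [x _ <-] /ltW hx] := subspace_subproof h.
exists x; apply: le_trans hx.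
by rewrite -ler_sqr ?nnegrE// !hnormE.
Qed.

Lemma to_ran_linear H K (D : {bounded H -> K}) : linear (to_ran D).
Proof. by move=> a x y; apply/val_inj; rewrite /= linearP. Qed.

Lemma to_ran_dot H K (D : {bounded H -> K}) x y :
  hdot (to_ran D x) (to_ran D y) = hdot (D x) (D y).
Proof. by []. Qed.

Lemma to_ran_norm H K (D : {bounded H -> K}) x : `|to_ran D x| = `|D x| :> R[i].
Proof. by apply/eqP; rewrite -(eqrXn2 (n := 2))// !hnormE. Qed.

Definition total I H (f : I -> H) : Prop := closure (linear_span (range f)) = [set: H].

Lemma linear_spanP H (S : set H) (P : H -> Prop) :
  P 0 -> (forall (a : R[i]) u v, P u -> P v -> P (a *: u + v)) ->
  (forall u, S u -> P u) -> forall u, linear_span S u -> P u.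
Proof.
move=> P0 PD PS _ [n [a [s [sS ->]]]].
elim/big_ind: _ => // [u v Pu Pv|i _]; first by rewrite -[u]scale1r; exact: PD.
by rewrite -[_ *: _]addr0; apply: PD => //; exact/PS/sS.
Qed.

Lemma linear_span_linear H (S : set H) (a : R[i]) u v :
  linear_span S u -> linear_span S v -> linear_span S (a *: u + v).
Proof.
move=> [n [b [s [sS ->]]]] [m [c [t [tS ->]]]].
exists (n + m)%N, (fun i => match fintype.split i with inl j => a * b j | inr j => c j end),
  (fun i => match fintype.split i with inl j => s j | inr j => t j end); split.
  by move=> i; case: fintype.split.
rewrite big_split_ord scaler_sumr; congr (_ + _); apply: eq_bigr => i _.
  by rewrite (unsplitK (inl i)) scalerA.
by rewrite (unsplitK (inr i)).
Qed.

Lemma linear_span0 H (S : set H) : linear_span S 0.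
Proof. by exists 0%N, (fun=> 0), (fun=> 0); split => [[]//|]; rewrite big_ord0. Qed.

Lemma linear_span_gen H (S : set H) u : S u -> linear_span S u.
Proof. by exists 1%N, (fun=> 1), (fun=> u); split => //; rewrite big_ord1 scale1r. Qed.

Lemma total_dense I H (f : I -> H) (h : H) (e : R[i]) : total f -> 0 < e ->
  exists2 y, linear_span (range f) y & `|h - y| <= e.
Proof.
move=> tf e0; have /closure_normP/(_ e e0)[y fy /ltW hy] : closure (linear_span (range f)) h.
  by rewrite tf.
by exists y.
Qed.

(** For y in the span close to h, |h|^2 = <h - y, h> <= |h - y| |h|. *)
Lemma total_dot0 I H (f : I -> H) (h : H) :
  total f -> (forall i, hdot (f i) h = 0) -> h = 0.
Proof.
move=> tf fh; apply/eqP; rewrite -normr_le0; apply/ler_addgt0Pr => e e0; rewrite add0r.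
have [y fy hy] := total_dense h tf e0.
have yh : hdot y h = 0.
  apply: (@linear_spanP _ _ (fun u => hdot u h = 0)) fy => [|a u v u0 v0|_ [i _ <-]//].
    exact: linear0l.
  by rewrite hdotDl hdotZl u0 v0 mulr0 addr0.
have [->|h_neq0] := eqVneq h 0; first by rewrite normr0 ltW.
have hgt0 : 0 < `|h| by rewrite normr_gt0.
rewrite -(ler_pM2r hgt0) -expr2 hnormE -[hdot h h]subr0 -yh -hdotBl.
rewrite -[leLHS]ger0_norm; last by rewrite hdotBl yh subr0 dnorm_ge0.
by rewrite (le_trans (cauchy_schwarz _ _))// ler_wpM2r.
Qed.

Lemma total_eq I H K (f : I -> H) (F G : {bounded H -> K}) :
  total f -> (forall i, F (f i) = G (f i)) -> F =1 G.
Proof.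
move=> tf FG h; apply: hdot_eqP => w; rewrite [LHS]hdotC [RHS]hdotC !adjointP.
congr (Num.conj (hdot h _)); apply/eqP; rewrite -subr_eq0; apply/eqP.
by apply: (total_dot0 tf) => x; rewrite hdotBr -!adjointP FG subrr.
Qed.

Lemma total_to_ran H K (D : {bounded H -> K}) : total (to_ran D).
Proof.
apply/seteqP; split => // h _; apply/closure_normP => e e0.
have [x hx] : exists x, `|h - to_ran D x| <= e / 2.
  by apply: ran_closure_dense; rewrite divr_gt0.
exists (to_ran D x); first by apply: linear_span_gen; exists x.
by rewrite (le_lt_trans hx)// ltr_pdivrMr// ltr_pMr// ltr1n.
Qed.

(** Douglas factorization T = F D: the bound makes D x |-> T x well defined and contractive on the
    range of D, and it extends to the closure. *)
Lemma range_factor H K L (D : {bounded H -> K}) (T : H -> L) : linear T ->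
  (forall x, `|T x| <= `|D x| :> R[i]) ->
  exists F : {bounded subspace_of (ran_closure D) -> L},
    contraction F /\ forall x, F (to_ran D x) = T x.
Proof.
move=> lT TD.
have [|||F [cF FT]] := @contraction_extension R (subspace_of (ran_closure D)) L
  (fun u v => exists x, u = to_ran D x /\ v = T x).
- move=> a _ _ _ _ [x [-> ->]] [y [-> ->]]; exists (a *: x + y); rewrite lT.
  by split => //; apply/val_inj; rewrite /= linearP.
- move=> _ _ [x [-> ->]]; apply: le_trans (TD x) _.
  by rewrite -ler_sqr ?nnegrE// !hnormE.
- move=> h e e0; have [x hx] := ran_closure_dense h e0.
  by exists (to_ran D x), (T x); split => //; exists x.
by exists F; split => // x; apply: FT; exists x.
Qed.

(** The span of the pairs (f i, g i) is the graph of an isometry with dense domain and dense range.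
    Extending it and its inverse by continuity gives two mutually inverse contractions. *)
Lemma gram_unitary I H K (f : I -> H) (g : I -> K) : total f -> total g ->
  (forall i j, hdot (f i) (f j) = hdot (g i) (g j)) ->
  exists U : {bounded H -> K}, unitary U /\ forall i, U (f i) = g i.
Proof.
move=> tf tg fg.
pose G u v := linear_span (range (fun i => (f i, g i) : hsum H K)) ((u, v) : hsum H K).
have Gdot u v u' v' : G u v -> G u' v' -> hdot u u' = hdot v v'.
  move=> Guv Guv'.
  apply: (@linear_spanP _ _ (fun p : hsum H K => hdot p.1 u' = hdot p.2 v') _ _ _ _ Guv).
  - by rewrite !linear0l.
  - by move=> a p q; rewrite !linearDl/= !hdotZl => -> ->.
  move=> _ [i _ <-] /=.
  apply: (@linear_spanP _ _ (fun p : hsum H K => hdot (f i) p.1 = hdot (g i) p.2) _ _ _ _ Guv').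
  - by rewrite !linear0r.
  - by move=> a p q; rewrite !linearDr/= !hdotZr => -> ->.
  by move=> _ [j _ <-] /=; exact: fg.
have Gnorm u v : G u v -> `|u| = `|v| :> R[i].
  by move=> Guv; apply/eqP; rewrite -(eqrXn2 (n := 2))// !hnormE (Gdot _ _ _ _ Guv Guv).
have Gf u : linear_span (range f) u -> exists v, G u v.
  apply: (@linear_spanP _ _ (fun u => exists v, G u v)) => [|a p q [p' Gp] [q' Gq]|_ [i _ <-]].
  - by exists 0; exact: linear_span0.
  - by exists (a *: p' + q'); exact: linear_span_linear Gp Gq.
  - by exists (g i); apply: linear_span_gen; exists i.
have Gg v : linear_span (range g) v -> exists u, G u v.
  apply: (@linear_spanP _ _ (fun v => exists u, G u v)) => [|a p q [p' Gp] [q' Gq]|_ [i _ <-]].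
  - by exists 0; exact: linear_span0.
  - by exists (a *: p' + q'); exact: linear_span_linear Gp Gq.
  - by exists (f i); apply: linear_span_gen; exists i.
have [|||U [cU UG]] := @contraction_extension R H K G.
- by move=> a x y x' y'; exact: linear_span_linear.
- by move=> x y /Gnorm ->.
- move=> h e e0; have [y /Gf[v Gyv] hy] := total_dense h tf e0.
  by exists y, v.
have [|||V [cV VG]] := @contraction_extension R K H (fun v u => G u v).
- by move=> a x y x' y'; exact: linear_span_linear.
- by move=> x y /Gnorm ->.
- move=> h e e0; have [y /Gg[v Gyv] hy] := total_dense h tg e0.
  by exists y, v.
have UV y : U (V y) = y.
  apply/eqP; rewrite -subr_eq0 -normr_le0; apply/ler_addgt0Pr => e e0; rewrite add0r.
  have e20 : 0 < e / 2 by rewrite divr_gt0.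
  have [z /Gg[u Guz] yz] := total_dense y tg e20.
  rewrite -(subrKA z) [e]splitr (le_trans (ler_normD _ _))// lerD//; last by rewrite distrC.
  rewrite -[X in _ - X](UG _ _ Guz) -(VG _ _ Guz) -!linearB/=.
  exact: le_trans (cU _) (le_trans (cV _) yz).
exists U; split; last by move=> i; apply: UG; apply: linear_span_gen; exists i.
have VU x : V (U x) = x.
  apply/eqP; rewrite -subr_eq0 -normr_le0; apply/ler_addgt0Pr => e e0; rewrite add0r.
  have e20 : 0 < e / 2 by rewrite divr_gt0.
  have [z /Gf[u Guz] yz] := total_dense x tf e20.
  rewrite -(subrKA z) [e]splitr (le_trans (ler_normD _ _))// lerD//; last by rewrite distrC.
  rewrite -[X in _ - X](VG _ _ Guz) -(UG _ _ Guz) -!linearB/=.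
  exact: le_trans (cV _) (le_trans (cU _) yz).
split; last by move=> y; exists (V y).
have isoU x : hdot (U x) (U x) = hdot x x.
  apply/eqP; rewrite -!hnormE eqrXn2// eq_le cU/= -{1}(VU x); exact: cV.
(* Preservation of norms becomes preservation of inner products by polarizing U^* U - 1. *)
move=> x y; rewrite adjointP; congr (hdot x _); apply/eqP; rewrite -subr_eq0; apply/eqP.
apply: (@polarization0 H ((adjoint U \o U) \- idfun)) => z /=.
by rewrite hdotBl adjointPr isoU subrr.
Qed.

End operators.

(** * Positive square roots *)

Section square_root.
Context {R : realType}.
Implicit Types H K L : hilbertType R.

Definition hermitian_op H (X : H -> H) : Prop := forall x y, hdot (X x) y = hdot x (X y).

(* The iterates converge to 1 - (1 - X)^{1/2}, the solution of Y = (X + Y^2) / 2. *)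
Fixpoint sqrt_iter H (X : H -> H) (n : nat) (x : H) : H :=
  if n is n.+1 then 2^-1 *: (X x + sqrt_iter X n (sqrt_iter X n x)) else 0.

(* The same iteration for the scalar X = 1 dominates the operator iteration. *)
Fixpoint sqrt_bound (n : nat) : R :=
  if n is n.+1 then (1 + sqrt_bound n ^+ 2) / 2 else 0.

Lemma sqrt_bound_itv n : 0 <= sqrt_bound n <= 1.
Proof.
by elim: n => [|n /= /andP[t0 t1]]; [rewrite lexx ler01|apply/andP; split; nra].
Qed.

(** In terms of u = 1 - t the recursion is u |-> u - u^2 / 2, whose decay is of order 2 / n. *)
Lemma sqrt_bound_lower n : 1 - sqrt_bound n <= 2 / n.+2%:R.
Proof.
elim: n => [|n IH]; first by rewrite subr0 divff.
have /andP[t0 t1] := sqrt_bound_itv n.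
have n0 : 0 < n.+2%:R :> R by rewrite ltr0n.
have -> : n.+3%:R = n.+2%:R + 1 :> R by rewrite -natr1.
move: IH; rewrite /= !ler_pdivlMr ?addr_gt0//.
have : 2 <= n.+2%:R :> R by rewrite ler_nat.
move: (n.+2%:R : R) n0 (sqrt_bound n) t0 t1 => m m0 t t0 t1 m2 h.
set u := 1 - t in h.
have -> : 1 - (1 + t ^+ 2) / 2 = u - u ^+ 2 / 2 by rewrite /u; field.
have u0 : 0 <= u by rewrite subr_ge0.
have u1 : u <= 1 by rewrite /u; lra.
rewrite -subr_ge0.
have E : 2 - (u - u ^+ 2 / 2) * (m + 1) =
   (2 - u * m) * (1 - u / 2) + u ^+ 2 / 2 by field.
rewrite E addr_ge0 ?mulr_ge0 ?subr_ge0 ?exprn_ge0//.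
by lra.
Qed.

(** Serves to pass to the limit in estimates that carry the convergence rate of the iterates. *)
Lemma le_eps0 (a c : R[i]) : 0 <= c ->
  (forall n : nat, a <= 2 * n.+1%:R^-1 * c) -> a <= 0.
Proof.
move=> c0 h; apply/ler_addgt0Pr => e e0; rewrite add0r.
have c1 : 0 < 2 * (c + 1) by rewrite mulr_gt0// ltr_wpDl.
have [|N /(_ N (leqnn N)) NP] := @invSn_small R (e / (2 * (c + 1))).
  by rewrite divr_gt0.
apply: le_trans (h N) _; rewrite mulrAC mulrC.
apply: (@le_trans _ _ (N.+1%:R^-1 * (2 * (c + 1)))).
  by rewrite ler_wpM2l// ler_wpM2l// lerDl.
by rewrite -ler_pdivlMr.
Qed.

Section iterates.
Variables (H : hilbertType R) (X : {bounded H -> H}).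
Hypothesis X_contr : contraction X.
Hypothesis X_herm : hermitian_op X.
Local Notation Y := (sqrt_iter X).
Let t n : R[i] := (sqrt_bound n)%:C.

Lemma sqrt_iter_linear n : linear (Y n).
Proof.
elim: n => [|n IH] a x y /=; first by rewrite scaler0 addr0.
rewrite linearP !IH scalerA [a * _]mulrC -scalerA -scalerDr; congr (_ *: _).
by rewrite scalerDr addrACA.
Qed.

Lemma sqrt_iterB n x y : Y n (x - y) = Y n x - Y n y.
Proof.
by have := sqrt_iter_linear n (-1) y x; rewrite !scaleN1r => h; rewrite addrC h addrC.
Qed.

Let t_ge0 n : 0 <= t n.
Proof. by rewrite lecR; have /andP[] := sqrt_bound_itv n. Qed.

Let t_le1 n : t n <= 1.
Proof. by rewrite lecR; have /andP[] := sqrt_bound_itv n. Qed.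

Let tS n : t n.+1 = (1 + t n ^+ 2) / 2.
Proof. by rewrite /t /= rmorphM rmorphD/= rmorphXn/= fmorphV/= rmorph_nat. Qed.

Let half0 : 0 <= 2^-1 :> R[i].
Proof. by rewrite invr_ge0. Qed.

Lemma sqrt_iter_norm n x : `|Y n x| <= t n * `|x|.
Proof.
elim: n x => [|n IH] x; first by rewrite normr0 mulr_ge0.
rewrite /= normrZ ger0_norm// tS mulrAC [leRHS]mulrC ler_wpM2l//.
rewrite (le_trans (ler_normD _ _))// mulrDl mul1r lerD//.
by rewrite (le_trans (IH _))// expr2 -mulrA ler_wpM2l.
Qed.

Lemma sqrt_iter_step n x : `|Y n.+1 x - Y n x| <= (t n.+1 - t n) * `|x|.
Proof.
elim: n x => [|n IH] x.
  rewrite subr0 [t 0]/(0%:C) subr0; exact: sqrt_iter_norm.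
(* The scalar sequence increases because 2 (t n.+1 - t n) = (1 - t n)^2. *)
have d0 : 0 <= t n.+1 - t n.
  rewrite tS -(pmulr_rge0 _ (ltr0n R[i] 2)) mulrBr mulrCA divff// mulr1.
  by have : 0 <= (1 - t n) ^+ 2; [rewrite -realEsqr ger0_real// subr_ge0|congr (0 <= _); ring].
(* A difference of squares split with the order of factors kept; each summand contains the previous
   increment, and the scalar increment splits in the same way. *)
have -> : Y n.+2 x - Y n.+1 x = 2^-1 *: ((Y n.+1 (Y n.+1 x) - Y n (Y n.+1 x))
     + Y n (Y n.+1 x - Y n x)).
  rewrite sqrt_iterB subrKA [Y n.+2 x]/(2^-1 *: _) [Y n.+1 x in LHS]/(2^-1 *: _).
  by rewrite -scalerBr opprD addrACA subrr add0r.
have -> : t n.+2 - t n.+1 = 2^-1 * ((t n.+1 - t n) * t n.+1 + t n * (t n.+1 - t n)).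
  by rewrite [t n.+2]tS {2}[t n.+1]tS; field.
rewrite normrZ ger0_norm// -mulrA ler_wpM2l// mulrDl (le_trans (ler_normD _ _))// lerD//.
  by rewrite (le_trans (IH _))// -mulrA ler_wpM2l// sqrt_iter_norm.
by rewrite (le_trans (sqrt_iter_norm _ _))// -mulrA ler_wpM2l.
Qed.

(** The steps telescope to t m - t n <= 1 - t n <= 2 / (n + 2). *)
Lemma sqrt_iter_cauchy n m x : (n <= m)%N -> `|Y m x - Y n x| <= 2 * n.+1%:R^-1 * `|x|.
Proof.
move=> nm; apply: (@le_trans _ _ ((t m - t n) * `|x|)).
  rewrite -(subnK nm); elim: (m - n)%N => [|k IH].
    by rewrite add0n !subrr normr0 mul0r.
  rewrite addSn -(subrKA (Y (k + n)%N x)) -(subrKA (t (k + n)%N)) mulrDl.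
  by rewrite (le_trans (ler_normD _ _))// lerD// sqrt_iter_step.
rewrite ler_wpM2r// (le_trans (lerD (t_le1 m) (lexx _)))//.
apply: (@le_trans _ _ ((2 / n.+2%:R : R)%:C)).
  by rewrite -rmorphB lecR sqrt_bound_lower.
rewrite rmorphM/= fmorphV/= !rmorph_nat ler_wpM2l//.
by rewrite lef_pV2 ?posrE ?ltr0n// ler_nat.
Qed.

Lemma sqrt_iter_herm n : hermitian_op (Y n).
Proof.
elim: n => [|n IH] x y; first by rewrite linear0l linear0r.
have c2 : Num.conj 2^-1 = 2^-1 :> R[i] by apply/CrealP; rewrite ger0_real// invr_ge0.
by rewrite [sqrt_iter _ _ x]/= [sqrt_iter _ _ y]/= hdotZl hdotZr c2 hdotDl hdotDr X_herm !IH.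
Qed.

(** The limit L of the iterates satisfies 2 L = X + L^2, so Q = 1 - L has square 1 - 2 L + L^2 = 1 -
    X. It is positive because L is a Hermitian contraction. The rate is recorded so that
    intertwining relations pass to the limit. *)
Lemma sqrt_exists : exists Q : {bounded H -> H}, [/\ op_le null_op Q,
  forall x, Q (Q x) = x - X x &
  forall n x, `|Y n x - (x - Q x)| <= 2 * n.+1%:R^-1 * `|x|].
Proof.
have /choice[L LP] : forall x, exists l, forall n, `|Y n x - l| <= 2 * n.+1%:R^-1 * `|x|.
  move=> x; have [|l lP] := @hnorm_cauchy_cvg R H (fun n => Y n x).
    move=> e e0; have x1 : 0 < 2 * (`|x| + 1) by rewrite mulr_gt0// ltr_wpDl.
    have [|N NP] := @invSn_small R (e / (2 * (`|x| + 1))); first by rewrite divr_gt0.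
    have h n : (N <= n)%N -> 2 * n.+1%:R^-1 * `|x| <= e.
      move=> /NP; rewrite ler_pdivlMr//; apply: le_trans.
      by rewrite -mulrA mulrCA ler_wpM2l// ler_wpM2l// lerDl.
    exists N => m n Nm Nn; case/orP: (leq_total m n) => mn.
      by rewrite distrC (le_trans (sqrt_iter_cauchy _ mn))// h.
    by rewrite (le_trans (sqrt_iter_cauchy _ mn))// h.
  exists l => n; apply/ler_addgt0Pr => e /lP[N NP].
  rewrite -(subrKA (Y (maxn n N) x)) (le_trans (ler_normD _ _))// lerD//.
    by rewrite distrC sqrt_iter_cauchy// leq_maxl.
  by rewrite NP// leq_maxr.
have eps0 n : 0 <= 2 * n.+1%:R^-1 :> R[i] by rewrite mulr_ge0.
have Llin : linear L.
  move=> a x y; apply/eqP; rewrite -subr_eq0 -normr_le0.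
  apply: (@le_eps0 _ (`|a *: x + y| + (`|a| * `|x| + `|y|))).
    by rewrite !addr_ge0// mulr_ge0.
  move=> n; rewrite -(subrKA (Y n (a *: x + y))) mulrDr (le_trans (ler_normD _ _))// lerD//.
    by rewrite distrC.
  rewrite sqrt_iter_linear opprD addrACA -scalerBr (le_trans (ler_normD _ _))// mulrDr.
  by rewrite lerD// normrZ mulrCA ler_wpM2l.
have Lnorm x : `|L x| <= `|x|.
  rewrite -subr_le0; apply: (@le_eps0 _ `|x|) => // n; rewrite lerBlDr.
  rewrite -(subrK (Y n x) (L x)) (le_trans (ler_normD _ _))// lerD//; first by rewrite distrC.
  by rewrite (le_trans (sqrt_iter_norm _ _))// ler_piMl.
have Lfix x : 2 *: L x = X x + L (L x).
  apply/eqP; rewrite -subr_eq0 -normr_le0.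
  apply: (@le_eps0 _ (2 * `|x| + (`|x| + `|x|))); first by rewrite !addr_ge0// mulr_ge0.
  move=> n.
  (* Each difference is controlled by the rate at index n or n + 1, since [Y n] is a contraction. *)
  have -> : 2 *: L x - (X x + L (L x)) = 2 *: (L x - Y n.+1 x)
      + (Y n (Y n x - L x) + (Y n (L x) - L (L x))).
    rewrite sqrt_iterB subrKA scalerBr /= scalerA divff// scale1r.
    by rewrite !opprD !addrA subrK.
  rewrite mulrDr (le_trans (ler_normD _ _))// lerD//.
    rewrite normrZ ger0_norm// mulrCA ler_wpM2l// distrC (le_trans (LP _ _))//.
    rewrite ler_wpM2r// ler_wpM2l// lef_pV2 ?posrE ?ltr0n// ler_nat//.
  rewrite (le_trans (ler_normD _ _))// mulrDr lerD//.
    by rewrite (le_trans (sqrt_iter_norm _ _))// (le_trans _ (LP x n))// ler_piMl.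
  by rewrite (le_trans (LP _ _))// ler_wpM2l.
have Lherm x y : hdot (L x) y = hdot x (L y).
  apply/eqP; rewrite -subr_eq0 -normr_le0.
  apply: (@le_eps0 _ (`|x| * `|y| + `|x| * `|y|)); first by rewrite addr_ge0 ?mulr_ge0.
  move=> n; rewrite -(subrKA (hdot (Y n x) y)) {2}sqrt_iter_herm -hdotBl -hdotBr.
  rewrite (le_trans (ler_normD _ _))// mulrDr lerD// (le_trans (cauchy_schwarz _ _))//.
    by rewrite mulrA ler_wpM2r// distrC.
  by rewrite mulrCA ler_wpM2l.
have [||Q QE] := @bounded_of R H H (fun x => x - L x) 2.
- by move=> a x y; rewrite Llin opprD addrACA scalerBr.
- by move=> x; rewrite (le_trans (ler_normB _ _))// mulr_natl mulr2n lerD.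
exists Q; split=> [x|x|n x]; last by rewrite QE subKr.
  rewrite /null_op/= subr0 QE hdotBl subr_ge0.
  have Lr : hdot (L x) x \is Num.real by apply/CrealP; rewrite -hdotC Lherm.
  rewrite (le_trans (real_ler_norm Lr))// (le_trans (cauchy_schwarz _ _))//.
  by rewrite -hnormE expr2 ler_wpM2r.
have LB u v : L (u - v) = L u - L v.
  by have := Llin (-1) v u; rewrite !scaleN1r => h; rewrite addrC h addrC.
rewrite !QE LB opprB -addrA; congr (_ + _); rewrite addrA addrC addrA -opprD.
by rewrite -mulr2n -scaler_nat Lfix opprD addrNK.
Qed.

End iterates.
End square_root.

(** * Uniqueness and intertwining of positive square roots *)

Section positive_square_root.
Context {R : realType}.
Implicit Types H K L : hilbertType R.

Lemma sqrt_iter_intertwine H K (X : H -> H) (X' : K -> K) (W : {linear H -> K}) :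
  (forall x, X' (W x) = W (X x)) ->
  forall n x, sqrt_iter X' n (W x) = W (sqrt_iter X n x).
Proof.
move=> XW; elim=> [|n IH] x /=; first by rewrite linear0.
by rewrite XW !IH -linearD -linearZ.
Qed.

Lemma sqrt_limit_intertwine H K (X : H -> H) (X' : K -> K) (Q : H -> H) (Q' : K -> K)
    (W : {bounded H -> K}) :
  (forall x, X' (W x) = W (X x)) ->
  (forall n x, `|sqrt_iter X n x - (x - Q x)| <= 2 * n.+1%:R^-1 * `|x| :> R[i]) ->
  (forall n x, `|sqrt_iter X' n x - (x - Q' x)| <= 2 * n.+1%:R^-1 * `|x| :> R[i]) ->
  forall x, Q' (W x) = W (Q x).
Proof.
move=> XW QP QP' x; have [M M0 WM] := bounded_lipschitz W.
apply/eqP; rewrite -subr_eq0 -normr_le0.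
apply: (@le_eps0 _ _ (`|W x| + M * `|x|)); first by rewrite addr_ge0// mulr_ge0.
move=> n; have -> : Q' (W x) - W (Q x) = (sqrt_iter X' n (W x) - (W x - Q' (W x)))
    - W (sqrt_iter X n x - (x - Q x)).
  have WB : W (sqrt_iter X n x - (x - Q x)) = W (sqrt_iter X n x) - (W x - W (Q x)).
    by rewrite 2!linearB.
  rewrite (sqrt_iter_intertwine XW) WB [_ - (W x - Q' _)]addrC addrKA opprK.
  by rewrite opprB subrKA.
rewrite (le_trans (ler_normB _ _))// mulrDr lerD// (le_trans (WM _))//.
by rewrite mulrCA ler_wpM2l.
Qed.

(** Let D = Q - Q'. Commutation gives (Q + Q') D = Q^2 - Q'^2 = 0, so the nonnegative numbers <Q D
    x, D x> and <Q' D x, D x> sum to zero and both vanish. Hence <D^3 x, x> = 0, so D^3 = 0, and D =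
    0 because D is Hermitian. *)
Lemma pos_sqrt_unique H (P : H -> H) (Q Q' : {bounded H -> H}) :
  op_le null_op Q -> op_le null_op Q' -> (forall x, Q (Q x) = P x) ->
  (forall x, Q' (Q' x) = P x) -> (forall x, Q (Q' x) = Q' (Q x)) -> Q =1 Q'.
Proof.
move=> Q0 Q0' QQ QQ' comm.
have hQ := pos_hermitian Q0; have hQ' := pos_hermitian Q0'.
pose D : {linear H -> H} := Q \- Q'.
have DE x : D x = Q x - Q' x by [].
have hD x y : hdot (D x) y = hdot x (D y) by rewrite !DE hdotBl hdotBr hQ hQ'.
have D3 x : hdot (D (D (D x))) x = 0.
  rewrite hD; set w := D x.
  have : hdot (Q w) w + hdot (Q' w) w = 0.
    rewrite -hdotDl /w DE !linearB/= !QQ !QQ' comm addrC addrA subrK subrr.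
    by rewrite linear0l.
  have := Q0 w; have := Q0' w; rewrite !subr0 => q' q /eqP.
  rewrite paddr_eq0// => /andP[/eqP q1 /eqP q2].
  by rewrite DE hdotBl q1 q2 subrr.
have {}D3 := @polarization0 _ H (D \o (D \o D)) D3.
have D2 x : D (D x) = 0.
  apply/eqP; rewrite -(dnorm_eq0 (@hdot R H))/= -hD.
  by have /= -> := D3 x; rewrite linear0l.
move=> x; apply/eqP; rewrite -subr_eq0 -DE -(dnorm_eq0 (@hdot R H))/= -hD D2.
by rewrite linear0l.
Qed.

Section square_roots_of_defects.
Variables (H : hilbertType R) (X : {bounded H -> H}).
Hypothesis X_contr : contraction X.
Hypothesis X_herm : hermitian_op X.

Let Q := pos_sqrt (fun x => x - X x).

Lemma pos_sqrtP : [/\ op_le null_op Q, hermitian_op Q & forall x, Q (Q x) = x - X x].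
Proof.
have [S [S0 SS _]] := sqrt_exists X_contr X_herm.
have [Q0 QQ] := @xgetPex _ (@null_op R H H)
  [set Q : {bounded H -> H} | op_le null_op Q /\ forall x, Q (Q x) = x - X x]
  (ex_intro _ S (conj S0 SS)).
by split=> //; exact: pos_hermitian.
Qed.

(** [pos_sqrt] picks some positive root Q of 1 - X. It commutes with X = 1 - Q^2, hence with the
    root S approximated by the iterates, and uniqueness gives Q = S. *)
Lemma pos_sqrt_limit n x : `|sqrt_iter X n x - (x - Q x)| <= 2 * n.+1%:R^-1 * `|x| :> R[i].
Proof.
have [S [S0 SS SP]] := sqrt_exists X_contr X_herm.
have [Q0 _ QQ] := pos_sqrtP.
have XQ y : X (Q y) = Q (X y).
  have XE z : X z = z - Q (Q z) by rewrite QQ subKr.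
  by rewrite !XE linearB.
rewrite -(pos_sqrt_unique S0 Q0 SS QQ) => [|y]; first exact: SP.
exact: (sqrt_limit_intertwine XQ SP SP).
Qed.

End square_roots_of_defects.
Lemma pos_sqrt_intertwine H K (X : {bounded H -> H}) (X' : {bounded K -> K})
    (W : {bounded H -> K}) :
  contraction X -> hermitian_op X -> contraction X' -> hermitian_op X' ->
  (forall x, X' (W x) = W (X x)) ->
  forall x, pos_sqrt (fun y => y - X' y) (W x) = W (pos_sqrt (fun y => y - X y) x).
Proof.
move=> cX hX cX' hX' XW.
exact: (sqrt_limit_intertwine XW (pos_sqrt_limit cX hX) (pos_sqrt_limit cX' hX')).
Qed.

End positive_square_root.

(** * Defect operators of a row contraction *)

Section defects.
Context {R : realType} {d : nat}.
Implicit Types H K L : hilbertType R.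

Lemma adjoint_row_op H K (T : 'I_d -> {bounded H -> K}) y i :
  adjoint (row_op T) y i = adjoint (T i) y.
Proof.
have -> : adjoint (row_op T) y = [ffun i => adjoint (T i) y].
  apply: adjoint_eq => x; rewrite hpow_dotE /row_op hdot_suml.
  by apply: eq_bigr => j _; rewrite ffunE adjointP.
by rewrite ffunE.
Qed.

(** The operator inequality says that the adjoint of the row is a contraction, and this property
    passes between an operator and its adjoint. *)
Lemma row_contractionP H (T : 'I_d -> {bounded H -> H}) :
  row_contraction T -> contraction (row_op T).
Proof.
move=> cT; apply: adjointK_contraction => h.
rewrite -ler_sqr ?nnegrE// !hnormE hpow_dotE -subr_ge0.
apply: le_trans (cT h) _; rewrite hdotBl hdot_suml lerD2l lerN2.
by apply: ler_sum => i _; rewrite adjoint_row_op -adjointP.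
Qed.

Section defect_of_contraction.
Variables (H : hilbertType R) (T : 'I_d -> {bounded H -> H}).
Hypothesis T_contr : contraction (row_op T).

Let gram_contr : contraction (adjoint (row_op T) \o row_op T).
Proof. by move=> x; apply: le_trans (adjoint_contraction T_contr _) (T_contr _). Qed.

Let gram_herm : hermitian_op (adjoint (row_op T) \o row_op T).
Proof. by move=> x y /=; rewrite adjointPr adjointP. Qed.

Let cogram_contr : contraction (row_op T \o adjoint (row_op T)).
Proof. by move=> x; apply: le_trans (T_contr _) (adjoint_contraction T_contr _). Qed.

Let cogram_herm : hermitian_op (row_op T \o adjoint (row_op T)).
Proof. by move=> x y /=; rewrite adjointP adjointPr. Qed.

Lemma defectP : hermitian_op (defect T) /\
  forall x, defect T (defect T x) = x - adjoint (row_op T) (row_op T x).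
Proof. by have [] := pos_sqrtP gram_contr gram_herm. Qed.

Lemma defect_starP : hermitian_op (defect_star T) /\
  forall x, defect_star T (defect_star T x) = x - row_op T (adjoint (row_op T) x).
Proof. by have [] := pos_sqrtP cogram_contr cogram_herm. Qed.

Lemma defect_dot x y :
  hdot (defect T x) (defect T y) = hdot x y - hdot (row_op T x) (row_op T y).
Proof. by have [hD DD] := defectP; rewrite hD DD hdotBr adjointP. Qed.

Lemma defect_star_dot x y : hdot (defect_star T x) (defect_star T y) =
  hdot x y - \sum_i hdot (adjoint (T i) x) (adjoint (T i) y).
Proof.
have [hD DD] := defect_starP; rewrite hD DD hdotBr; congr (_ - _).
rewrite -adjointPr hpow_dotE.
by apply: eq_bigr => i _; rewrite !adjoint_row_op.
Qed.

(** T intertwines T^* T with T T^*, hence also the square roots of 1 - T^* T and 1 - T T^*. *)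
Lemma row_op_defect x : row_op T (defect T x) = defect_star T (row_op T x).
Proof.
apply/esym.
exact: (pos_sqrt_intertwine gram_contr gram_herm cogram_contr cogram_herm).
Qed.

End defect_of_contraction.
End defects.

(** * The Fock space *)

Section fock_space.
Context {R : realType} {d : nat}.
Implicit Types H K L : hilbertType R.
#[local] Existing Instance summability.totally_filter.

(** The words of length less than n, arranged so that sums split over the first letter. Every finite
    set of words lies in such a list, so these sums decide square summability. *)
Fixpoint short_words (n : nat) : seq (word d) :=
  if n is n.+1 then [::] :: [seq j :: w | j <- enum 'I_d, w <- short_words n] else [::].

Lemma mem_short_words n (w : word d) : (size w < n)%N -> w \in short_words n.
Proof.
elim: n w => [//|n IH] [|j w] /= wn; rewrite inE//=.
by apply: allpairs_f; [rewrite mem_enum|exact: IH].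
Qed.

Lemma short_words_uniq n : uniq (short_words n).
Proof.
elim: n => //= n IH; apply/andP; split.
  by apply/negP => /allpairsP[[j w] [_ _]].
by apply: allpairs_uniq => //; [exact: enum_uniq|move=> [i u] [j v] _ _ [-> ->]].
Qed.

Lemma big_short_words (V : nmodType) (a : word d -> V) n :
  \sum_(w <- short_words n.+1) a w =
  a [::] + \sum_(j < d) \sum_(w <- short_words n) a (j :: w).
Proof. by rewrite /= big_cons big_allpairs_dep big_enum. Qed.

Lemma uniq_sum_le (I : eqType) (a : I -> R[i]) (r s : seq I) : (forall i, 0 <= a i) ->
  uniq r -> {subset r <= s} -> \sum_(i <- r) a i <= \sum_(i <- s) a i.
Proof.
move=> a0; elim: r s => [|x r IH] s /=; first by rewrite big_nil sumr_ge0.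
move=> /andP[xr ur] rs; have xs : x \in s by rewrite rs// mem_head.
rewrite big_cons [leRHS](big_rem x)//= lerD2l; apply: IH => // y yr.
have yx : y != x by apply: contraNneq xr => <-.
have : y \in x :: rem x s by rewrite -(perm_mem (perm_to_rem xs)) rs// inE yr orbT.
by rewrite inE (negPf yx).
Qed.

Lemma short_words_sum_le (a : word d -> R[i]) (M : R[i]) : (forall w, 0 <= a w) ->
  (forall n, \sum_(w <- short_words n) a w <= M) ->
  forall A : {fset word d}, \sum_(w <- A) a w <= M.
Proof.
move=> a0 aM A; apply: le_trans (aM (\max_(w <- A) size w).+1).
apply: uniq_sum_le => // w wA.
by apply: mem_short_words; rewrite ltnS (leq_bigmax_seq (F := size)).
Qed.

Lemma short_words_le_norm H (F : fock_tensor d H) n :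
  \sum_(w <- short_words n) `|F w| ^+ 2 <= `|F| ^+ 2.
Proof.
rewrite [leRHS]hnormE l2_dotE; apply: le_trans (l2_sum_le F [fset w in short_words n]%fset).
apply: uniq_sum_le => [w||w]; [by rewrite exprn_ge0|exact: short_words_uniq|].
by rewrite in_fset.
Qed.

Lemma fock_tensor_exists H (f : word d -> H) (M : R[i]) :
  (forall n, \sum_(w <- short_words n) `|f w| ^+ 2 <= M) ->
  exists F : fock_tensor d H, F =1 f /\ `|F| ^+ 2 <= M.
Proof.
move=> fM.
have fA (A : {fset word d}) : \sum_(w <- A) `|f w| ^+ 2 <= M.
  by apply: short_words_sum_le => // w; rewrite exprn_ge0.
have f2 : f \in @square_summable_pred R (word d) H by apply/asboolP; exists M.
exists (L2 f2); split => //.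
by rewrite hnormE l2_dotE; exact: l2_dot_le.
Qed.

Lemma fock_tensorP H (F G : fock_tensor d H) : F =1 G -> F = G.
Proof. by move=> FG; apply/val_inj/funext. Qed.

Lemma fock_addE H (F G : fock_tensor d H) w : (F + G) w = F w + G w.
Proof. by []. Qed.

Lemma fock_oppE H (F : fock_tensor d H) w : (- F) w = - F w.
Proof. by []. Qed.

Lemma fock_sumE H (I : Type) (r : seq I) (P : pred I) (F : I -> fock_tensor d H) w :
  (\sum_(i <- r | P i) F i) w = \sum_(i <- r | P i) F i w.
Proof. exact: (big_morph (fun f : fock_tensor d H => f w)). Qed.

Lemma fock_coord_bounded H (w : word d) :
  exists p : {bounded fock_tensor d H -> H}, forall F, p F = F w.
Proof.
have [||p pE] := @bounded_of R (fock_tensor d H) H (fun F => F w) 1; last by exists p.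
  by [].
move=> F; rewrite mul1r -ler_sqr ?nnegrE// [leRHS]hnormE l2_dotE.
exact: l2_term_le.
Qed.

Lemma tensor_basisE H (w v : word d) (h : H) :
  tensor (fock_basis w) h v = (v == w)%:R *: h.
Proof. by []. Qed.

Lemma fock_basis_sumE H (F : fock_tensor d H) :
  summability.sum (fun w => tensor (fock_basis w) (F w)) = F.
Proof. by apply: cvg_lim; [exact: norm_hausdorff|exact: fock_basis_sum]. Qed.

(** The left creation operator by e_k. Its continuity carries the basis expansion of F to the sum
    over the words [k :: v]. *)
Lemma creation_exists H (k : 'I_d) : exists S : {bounded fock_tensor d H -> fock_tensor d H},
  forall F w, S F w = if w is j :: v then if j == k then F v else 0 else 0.
Proof.
have /choice[S SP] : forall F : fock_tensor d H, exists G : fock_tensor d H,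
    (G =1 fun w => if w is j :: v then if j == k then F v else 0 else 0)
    /\ `|G| ^+ 2 <= `|F| ^+ 2.
  move=> F; apply: fock_tensor_exists => -[|n].
    by rewrite big_nil exprn_ge0.
  rewrite big_short_words normr0 expr0n add0r (bigD1 k)//= eqxx [X in _ + X]big1 ?addr0; last first.
    by move=> j /negPf jk; rewrite big1// => w _; rewrite jk normr0 expr0n.
  exact: short_words_le_norm.
have [||T TE] := @bounded_of R _ _ S 1; last first.
- by exists T => F w; rewrite TE; have [-> _] := SP F.
- by move=> F; rewrite mul1r -ler_sqr ?nnegrE//; have [] := SP F.
move=> a F G; apply: fock_tensorP => w; rewrite l2_lincE.
have [-> _] := SP (a *: F + G); have [-> _] := SP F; have [-> _] := SP G.
by case: w => [|j w]; [|case: ifP => _]; rewrite ?scaler0 ?addr0 ?l2_lincE.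
Qed.

Lemma creation_basis_sumE H (k : 'I_d) (F : fock_tensor d H) (w : word d) :
  summability.sum (fun v => tensor (fock_basis (k :: v)) (F v)) w =
  if w is j :: v then if j == k then F v else 0 else 0.
Proof.
have [S SE] := creation_exists H k; rewrite -SE; congr (l2_fun _ w).
apply: cvg_lim; first exact: norm_hausdorff.
rewrite (_ : summability.partial_sum _ = S \o
  summability.partial_sum (fun v => tensor (fock_basis v) (F v))).
  apply: cvg_comp; first exact: fock_basis_sum.
  exact: cts_fun.
apply/funext => A /=; rewrite /summability.partial_sum linear_sum/=; apply: eq_bigr => v _.
apply: fock_tensorP => -[|j u]; rewrite SE !tensor_basisE ?scale0r// eqseq_cons.
by case: eqP; rewrite ?scale0r.
Qed.

End fock_space.

(** * The contraction gamma *)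

Section components.
Context {R : realType} {d : nat} {H K : hilbertType R}.

Definition hpow_fst (x : hpow d (hsum H K)) : hpow d H := [ffun i => (x i).1].
Definition hpow_snd (x : hpow d (hsum H K)) : hpow d K := [ffun i => (x i).2].

Lemma hpow_fst_linear : linear hpow_fst.
Proof. by move=> a x y; apply/ffunP => i; rewrite !ffunE. Qed.

Lemma hpow_snd_linear : linear hpow_snd.
Proof. by move=> a x y; apply/ffunP => i; rewrite !ffunE. Qed.

Lemma hpow_hsum_dot (x y : hpow d (hsum H K)) :
  hdot x y = hdot (hpow_fst x) (hpow_fst y) + hdot (hpow_snd x) (hpow_snd y).
Proof.
rewrite !hpow_dotE -big_split/=; apply: eq_bigr => i _.
by rewrite !ffunE hsum_dotE.
Qed.

Lemma row_op_hinj (T : 'I_d -> {bounded H -> K}) j h : row_op T (hinj j h) = T j h.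
Proof.
rewrite /row_op (bigD1 j)//= ffunE eqxx big1 ?addr0// => i /negPf ij.
by rewrite ffunE ij linear0.
Qed.

End components.

Lemma hinj_linear (R : realType) (d : nat) (H : hilbertType R) (j : 'I_d) :
  linear (@hinj R d H j).
Proof.
by move=> a x y; apply/ffunP => i; rewrite !ffunE; case: eqP => // _; rewrite scaler0 addr0.
Qed.

Lemma hpow_sum_hinj (R : realType) (d : nat) (H : hilbertType R) (x : hpow d H) :
  x = \sum_j hinj j (x j).
Proof.
apply/ffunP => i; rewrite sum_ffunE (bigD1 i)//= ffunE eqxx big1 ?addr0// => j.
by rewrite ffunE eq_sym => /negPf ->.
Qed.

Lemma adjoint_comp (R : realType) (H K L : hilbertType R) (S : {bounded K -> L})
  (T : {bounded H -> K}) y : adjoint (S \o T) y = adjoint T (adjoint S y).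
Proof. by apply: adjoint_eq => x /=; rewrite !adjointP. Qed.

Lemma contraction_dot (R : realType) (H K : hilbertType R) (T : {bounded H -> K}) :
  contraction T -> forall x, hdot (T x) (T x) <= hdot x x.
Proof. by move=> cT x; rewrite -!hnormE ler_sqr ?nnegrE. Qed.

Lemma adjoint_op_word (R : realType) (d : nat) (H : hilbertType R)
    (T : 'I_d -> {bounded H -> H}) j (w : word d) y :
  adjoint (op_word T (j :: w)) y = adjoint (op_word T w) (adjoint (T j) y).
Proof. exact: adjoint_comp. Qed.

Section lifting.
Context {R : realType} {d : nat} {HC HA : hilbertType R}.
Variables (C : 'I_d -> {bounded HC -> HC}) (E : 'I_d -> {bounded hsum HC HA -> hsum HC HA}).
Hypotheses (C_contr : row_contraction C) (E_lift : contractive_lifting C E).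
Local Notation A := (lifting_A E).
Local Notation B := (lifting_B E).

Lemma row_op_lifting1 (x : hpow d (hsum HC HA)) : (row_op E x).1 = row_op C (hpow_fst x).
Proof.
rewrite -[LHS]/(hfst (row_op E x)) /row_op linear_sum/=; apply: eq_bigr => i _.
by rewrite ffunE (contractive_lifting_blocks E_lift).
Qed.

Lemma row_op_lifting2 (x : hpow d (hsum HC HA)) :
  (row_op E x).2 = row_op B (hpow_fst x) + row_op A (hpow_snd x).
Proof.
rewrite -[LHS]/(hsnd (row_op E x)) /row_op linear_sum -big_split/=.
by apply: eq_bigr => i _; rewrite !ffunE (contractive_lifting_blocks E_lift).
Qed.

Lemma row_op_lifting_dot (x y : hpow d (hsum HC HA)) : hdot (row_op E x) (row_op E y) =
  hdot (row_op C (hpow_fst x)) (row_op C (hpow_fst y)) +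
  hdot (row_op B (hpow_fst x) + row_op A (hpow_snd x))
       (row_op B (hpow_fst y) + row_op A (hpow_snd y)).
Proof. by rewrite hsum_dotE !row_op_lifting1 !row_op_lifting2. Qed.

Lemma row_op_lifting_contr (u : hpow d HC) (v : hpow d HA) :
  hdot (row_op C u) (row_op C u) + hdot (row_op B u + row_op A v) (row_op B u + row_op A v)
  <= hdot u u + hdot v v.
Proof.
pose x : hpow d (hsum HC HA) := [ffun i => (u i, v i) : hsum HC HA].
have x1 : hpow_fst x = u by apply/ffunP => i; rewrite !ffunE.
have x2 : hpow_snd x = v by apply/ffunP => i; rewrite !ffunE.
have := contraction_dot (row_contractionP E_lift.1) x.
by rewrite row_op_lifting_dot hpow_hsum_dot x1 x2.
Qed.

Lemma lifting_A_contr : contraction (row_op A).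
Proof.
move=> v; rewrite -ler_sqr ?nnegrE// [leLHS]hnormE [leRHS]hnormE.
have := row_op_lifting_contr 0 v.
by rewrite (linear0 (row_op C)) (linear0 (row_op B)) !linear0l !add0r.
Qed.

(** Since E is a contraction, |B x + A u|^2 <= |x|^2 - |C x|^2 + |u|^2 = |D_C x|^2 + |u|^2, so (D_C
    x, u) |-> B x + A u extends to a contraction Z. The second component of Z^* h is A^* h, and the
    first one factors through D_{*,A} h; the factor is gamma. *)
Lemma lifting_gammaP : contraction (lifting_gamma C E) /\
  forall h : HA, adjoint (row_op B) h =
    defect C (subspace_val (lifting_gamma C E (to_ran (defect_star A) h))).
Proof.
have cC := row_contractionP C_contr; have cA := lifting_A_contr.
suff [g gP] : exists g :
    {bounded subspace_of (defect_star_space A) -> subspace_of (defect_space C)},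
    contraction g /\ forall h : HA, adjoint (row_op B) h =
      defect C (subspace_val (g (to_ran (defect_star A) h))).
  apply: (@xgetPex _ null_op [set g : {bounded subspace_of (defect_star_space A) ->
      subspace_of (defect_space C)} | contraction g /\ forall h : HA,
    adjoint (row_op B) h = defect C (subspace_val (g (to_ran (defect_star A) h)))]).
  by exists g.
have [|||Z [cZ ZP]] := @contraction_extension R
    (hsum (subspace_of (defect_space C)) (hpow d HA)) HA
    (fun p y => exists x, p.1 = to_ran (defect C) x /\ y = row_op B x + row_op A p.2).
- move=> a p _ p' _ [x [px ->]] [x' [px' ->]]; exists (a *: x + x').
  rewrite /= px px' to_ran_linear; split => //.
  by rewrite !linearP scalerDr addrACA.
- move=> [t u] _ [x [/= -> ->]].
  have := row_op_lifting_contr x u; rewrite -lerBrDl addrAC => h.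
  rewrite -ler_sqr ?nnegrE// [leLHS]hnormE [leRHS]hnormE hsum_dotE/=.
  by rewrite to_ran_dot defect_dot.
- move=> [t u] e e0; have [x tx] := ran_closure_dense t e0.
  exists ((to_ran (defect C) x, u) : hsum _ _), (row_op B x + row_op A u).
  split; first by exists x.
  rewrite -ler_sqr ?nnegrE// ?(ltW e0)// hnormE hsum_dotE/= subrr linear0l addr0 -hnormE.
  by rewrite ler_sqr ?nnegrE// ltW.
have Z1 h x : hdot (to_ran (defect C) x) (adjoint Z h).1 = hdot (row_op B x) h.
  have <- : Z ((to_ran (defect C) x, 0) : hsum _ _) = row_op B x.
    by apply: ZP; exists x; rewrite (linear0 (row_op A)) addr0.
  by rewrite adjointP hsum_dotE (linear0l (@hdot R _)) addr0.
have Z2 h : (adjoint Z h).2 = adjoint (row_op A) h.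
  apply/esym/adjoint_eq => u.
  have E0 : Z ((0, u) : hsum _ _) = row_op A u.
    apply: ZP; exists 0; rewrite (linear0 (row_op B)) add0r; split => //.
    by apply/val_inj; rewrite /= linear0.
  transitivity (hdot (Z ((0, u) : hsum _ _)) h); first by rewrite E0.
  by rewrite adjointP hsum_dotE (linear0l (@hdot R _)) add0r.
(* Contractivity of Z^* bounds the squared norm of the first component by |h|^2 - |A^* h|^2 =
   |D_{*,A} h|^2. *)
have [||g [cg gE]] := @range_factor R HA HA _ (defect_star A) (fun h => (adjoint Z h).1).
- by move=> a u v; rewrite linearP.
- move=> h; rewrite -ler_sqr ?nnegrE// !hnormE defect_star_dot// lerBrDr.
  have := adjoint_contraction cZ h.
  rewrite -ler_sqr ?nnegrE// !hnormE hsum_dotE Z2 hpow_dotE.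
  by under [in X in _ + X <= _]eq_bigr do rewrite !adjoint_row_op.
exists g; split => // h; apply: adjoint_eq => x; rewrite gE -Z1.
by have [hD _] := defectP cC; rewrite -hD.
Qed.

Definition lifting_kernel (h : HA) : subspace_of (defect_space C) :=
  lifting_gamma C E (to_ran (defect_star A) h).

Lemma lifting_kernel_linear : linear lifting_kernel.
Proof. by move=> a x y; rewrite /lifting_kernel to_ran_linear linearP. Qed.

Lemma defect_lifting_kernel h :
  defect C (subspace_val (lifting_kernel h)) = adjoint (row_op B) h.
Proof. by have [_ ->] := lifting_gammaP. Qed.

Lemma lifting_kernel_norm h :
  `|lifting_kernel h| ^+ 2 <= `|h| ^+ 2 - \sum_i `|adjoint (A i) h| ^+ 2.
Proof.
have [cg _] := lifting_gammaP.
rewrite -[leRHS](_ : `|to_ran (defect_star A) h| ^+ 2 = _).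
  by rewrite ler_sqr ?nnegrE//; exact: cg.
rewrite to_ran_norm hnormE defect_star_dot; last exact: lifting_A_contr.
by rewrite -hnormE; congr (_ - _); apply: eq_bigr => i _; rewrite hnormE.
Qed.

(** A telescoping estimate: the empty word contributes at most |h|^2 minus the sum of the |A_j^*
    h|^2, and by induction the words starting with j contribute at most |A_j^* h|^2. *)
Lemma lifting_kernel_words h n :
  \sum_(w <- short_words n) `|lifting_kernel (adjoint (op_word A w) h)| ^+ 2 <= `|h| ^+ 2.
Proof.
elim: n h => [|n IH] h; first by rewrite big_nil exprn_ge0.
rewrite big_short_words.
have -> : adjoint (op_word A [::]) h = h by apply: adjoint_eq.
rewrite -lerBrDr (le_trans (lifting_kernel_norm h))// lerD2l lerN2.
apply: ler_sum => j _; apply: le_trans (IH (adjoint (A j) h)).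
by apply: ler_sum => w _; rewrite adjoint_op_word.
Qed.

End lifting.

(** * Values of the symbol *)

Section symbols.
Context {R : realType} {d : nat} {HC HA : hilbertType R}.
Variables (C : 'I_d -> {bounded HC -> HC}) (E : 'I_d -> {bounded hsum HC HA -> hsum HC HA}).
Local Notation A := (lifting_A E).
Local Notation B := (lifting_B E).
Local Notation kernel := (lifting_kernel C E).

(* The coordinates of the value of the symbol at D_E x. *)
Definition symbol_coord (x : hpow d (hsum HC HA)) (w : word d) : subspace_of (defect_space C) :=
  if w is j :: v then
    kernel (adjoint (op_word A v) (hpow_snd x j - adjoint (A j) (row_op E x).2))
  else to_ran (defect C) (hpow_fst x) - kernel (row_op E x).2.

Lemma symbol_coord_nil x :
  symbol_coord x [::] = to_ran (defect C) (hpow_fst x) - kernel (row_op E x).2.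
Proof. by []. Qed.

Lemma symbol_coord_cons x j v : symbol_coord x (j :: v) =
  kernel (adjoint (op_word A v) (hpow_snd x j - adjoint (A j) (row_op E x).2)).
Proof. by []. Qed.

Lemma symbol_coord_linear w : linear (symbol_coord ^~ w).
Proof.
move=> a x y; have snd_lin : (row_op E (a *: x + y)).2 = a *: (row_op E x).2 + (row_op E y).2.
  by rewrite linearP.
case: w => [|j v] /=; rewrite snd_lin.
  rewrite hpow_fst_linear to_ran_linear lifting_kernel_linear scalerBr opprD.
  by rewrite addrACA.
have kernel_lin u u' : kernel (adjoint (op_word A v) (a *: u + u')) =
    a *: kernel (adjoint (op_word A v) u) + kernel (adjoint (op_word A v) u').
  by rewrite linearP lifting_kernel_linear.
rewrite -kernel_lin; congr (kernel (adjoint (op_word A v) _)).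
by rewrite hpow_snd_linear 2!ffunE linearP scalerBr opprD addrACA.
Qed.

Hypotheses (C_contr : row_contraction C) (E_lift : contractive_lifting C E).

Let C_contr' := row_contractionP C_contr.
Let E_contr := row_contractionP E_lift.1.
Let A_contr := lifting_A_contr E_lift.

(** Put y = (E x)_A, t = D_C x_C, k = kernel y, u = x_A and z = A^* y. The nonempty words contribute
    at most |u - z|^2, so the sum is at most |t - k|^2 + |u - z|^2. The cross terms are <t, k> = <B
    x_C, y> and <u, z> = <A u, y>, which add up to |y|^2, while |k|^2 + |z|^2 <= |y|^2. What remains
    is |t|^2 + |u|^2 - |y|^2 = |D_E x|^2. *)
Lemma symbol_coord_sum x n :
  \sum_(w <- short_words n) `|symbol_coord x w| ^+ 2 <= `|defect E x| ^+ 2.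
Proof.
case: n => [|n]; first by rewrite big_nil exprn_ge0.
rewrite big_short_words.
set y := (row_op E x).2; set t := to_ran (defect C) (hpow_fst x); set k := kernel y.
set u := hpow_snd x; set z := adjoint (row_op A) y.
have bound_tail : \sum_(j < d) \sum_(v <- short_words n) `|symbol_coord x (j :: v)| ^+ 2
    <= hdot (u - z) (u - z).
  rewrite hpow_dotE; apply: ler_sum => j _.
  apply: le_trans (lifting_kernel_words C_contr E_lift _ n) _.
  by rewrite hnormE !ffunE adjoint_row_op.
apply: (le_trans (lerD (lexx _) bound_tail)).
rewrite [symbol_coord x _]/(t - k) [leRHS]hnormE [X in X + _]hnormE.
have yE : y = row_op B (hpow_fst x) + row_op A u by rewrite /y (row_op_lifting2 E_lift).
have tk : hdot t k = hdot (row_op B (hpow_fst x)) y.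
  have [hD _] := defectP C_contr'.
  by rewrite subspace_dotE hD defect_lifting_kernel// adjointP.
have kk : hdot k k <= hdot y y - hdot z z.
  rewrite -hnormE; apply: le_trans (lifting_kernel_norm C_contr E_lift y) _.
  rewrite hnormE lerD2l lerN2 hpow_dotE; apply: ler_sum => i _.
  by rewrite adjoint_row_op hnormE.
have uz : hdot u z = hdot (row_op A u) y by rewrite adjointP.
have yy : hdot y y = hdot (row_op B (hpow_fst x)) y + hdot (row_op A u) y.
  by rewrite -hdotDl -yE.
have yyC : hdot y y = hdot y (row_op B (hpow_fst x)) + hdot y (row_op A u).
  by rewrite -hdotDr -yE.
rewrite defect_dot// hpow_hsum_dot (row_op_lifting_dot E_lift) -/u -yE.
rewrite 2!hdotBl 4!hdotBr [hdot k t]hdotC tk -hdotC [hdot z u]hdotC uz -hdotC.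
rewrite to_ran_dot defect_dot// -subr_ge0; move: kk; rewrite -subr_ge0.
move: (hdot (hpow_fst x) _) (hdot (row_op C _) _) (hdot u u) (hdot z z) (hdot k k) => a b c e f.
rewrite [X in 0 <= X -> _](_ : _ = hdot y y + hdot y y - hdot y y - e - f); last by ring.
rewrite {1}yy yyC.
by move=> h; apply: le_trans h _; rewrite le_eqVlt; apply/orP; left; apply/eqP; ring.
Qed.

Lemma symbol_exists : exists theta : {bounded subspace_of (defect_space E) ->
    fock_tensor d (subspace_of (defect_space C))},
  forall x w, theta (to_ran (defect E) x) w = symbol_coord x w.
Proof.
have /choice[T TP] : forall x, exists F : fock_tensor d (subspace_of (defect_space C)),
    F =1 symbol_coord x /\ `|F| ^+ 2 <= `|defect E x| ^+ 2.
  by move=> x; apply: fock_tensor_exists => n; exact: symbol_coord_sum.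
have [||theta [_ thetaE]] := @range_factor R _ _ _ (defect E) T.
- move=> a x y; apply: fock_tensorP => w; rewrite l2_lincE.
  by rewrite !(fun z => (TP z).1) symbol_coord_linear.
- by move=> x; rewrite -ler_sqr ?nnegrE//; have [] := TP x.
by exists theta => x w; rewrite thetaE (TP x).1.
Qed.

End symbols.

Section symbol_values.
Context {R : realType} {d : nat} {HC HA : hilbertType R}.
Variables (C : 'I_d -> {bounded HC -> HC}) (E : 'I_d -> {bounded hsum HC HA -> hsum HC HA}).
Hypotheses (C_contr : row_contraction C) (E_lift : contractive_lifting C E).
Local Notation A := (lifting_A E).
Local Notation B := (lifting_B E).
Local Notation kernel := (lifting_kernel C E).

Lemma kernel_vector_exists h : exists F : fock_tensor d (subspace_of (defect_space C)),
  forall w, F w = kernel (adjoint (op_word A w) h).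
Proof.
have [F [FE _]] := fock_tensor_exists (lifting_kernel_words C_contr E_lift h).
by exists F.
Qed.

Lemma kernel0 : kernel 0 = 0.
Proof. by have := lifting_kernel_linear C E (-1) 0 0; rewrite scaler0 addr0 scaleN1r addNr. Qed.

Lemma kernelN h : kernel (- h) = - kernel h.
Proof.
by have := lifting_kernel_linear C E (-1) h 0; rewrite !scaleN1r kernel0 !addr0.
Qed.

Lemma hpow_fst_hinl (j : 'I_d) (h : HC) : hpow_fst (hinj j (hinl HA h)) = hinj j h.
Proof. by apply/ffunP => i; rewrite !ffunE; case: eqP. Qed.

Lemma hpow_snd_hinl (j : 'I_d) (h : HC) : hpow_snd (hinj j (hinl HA h)) = 0.
Proof. by apply/ffunP => i; rewrite !ffunE; case: eqP. Qed.

Lemma hpow_fst_hinr (j : 'I_d) (h : HA) : hpow_fst (hinj j (hinr HC h)) = 0.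
Proof. by apply/ffunP => i; rewrite !ffunE; case: eqP. Qed.

Lemma hpow_snd_hinr (j : 'I_d) (h : HA) : hpow_snd (hinj j (hinr HC h)) = hinj j h.
Proof. by apply/ffunP => i; rewrite !ffunE; case: eqP. Qed.

Lemma row_op_hinl (j : 'I_d) (h : HC) : (row_op E (hinj j (hinl HA h))).2 = B j h.
Proof.
rewrite (row_op_lifting2 E_lift) hpow_fst_hinl hpow_snd_hinl row_op_hinj.
by rewrite (linear0 (row_op A)) addr0.
Qed.

Lemma row_op_hinr (j : 'I_d) (h : HA) : (row_op E (hinj j (hinr HC h))).2 = A j h.
Proof.
rewrite (row_op_lifting2 E_lift) hpow_fst_hinr hpow_snd_hinr row_op_hinj.
by rewrite (linear0 (row_op B)) add0r.
Qed.

Lemma is_symbolP (theta : {bounded subspace_of (defect_space E) ->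
    fock_tensor d (subspace_of (defect_space C))}) :
  (forall x w, theta (to_ran (defect E) x) w = symbol_coord C E x w) -> is_symbol theta.
Proof.
move=> thetaE; split=> [j h|j h]; apply: fock_tensorP => w.
  have [F FE] := kernel_vector_exists (B j h).
  (* The empty word is dropped, as in the sum over |alpha| >= 1. *)
  pose f w := if (1 <= size w)%N then F w else 0.
  have [G [GE _]] : exists G : fock_tensor d (subspace_of (defect_space C)),
      G =1 f /\ `|G| ^+ 2 <= `|F| ^+ 2.
    apply: fock_tensor_exists => n; apply: le_trans (short_words_le_norm F n).
    by apply: ler_sum => v _; rewrite /f; case: ifP => //; rewrite normr0 expr0n exprn_ge0.
  rewrite (_ : summability.sum _ = G); last first.
    rewrite -[RHS]fock_basis_sumE; congr summability.sum; apply/funext => v.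
    rewrite GE /f; case: ifP => _; first by rewrite FE.
    by apply: fock_tensorP => u; rewrite tensor_basisE scaler0.
  rewrite thetaE l2_subE tensor_basisE GE /f.
  case: w => [|k v]; rewrite ?symbol_coord_nil ?symbol_coord_cons row_op_hinl.
    by rewrite eqxx scale1r subr0 hpow_fst_hinl.
  rewrite scale0r sub0r FE hpow_snd_hinl ffunE sub0r linearN kernelN.
  by rewrite adjoint_op_word.
have [_ DD] := defectP (lifting_A_contr E_lift).
(* The default 0 of [insubd] is not reached: A D_A = D_{*,A} A puts the vector in the range of
   D_{*,A}. *)
have insubE : insubd 0 (row_op A (defect A (hinj j h))) = to_ran (defect_star A) (A j h).
  rewrite row_op_defect ?row_op_hinj; last exact: lifting_A_contr E_lift.
  exact: (valKd 0 (to_ran (defect_star A) (A j h))).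
rewrite insubE thetaE.
have /choice[F FE] := fun k =>
  kernel_vector_exists ((defect A (defect A (hinj j h)) : hpow d HA) k).
have sumE k : summability.sum (fun alpha : word d => tensor (fock_basis (k :: alpha))
    (lifting_gamma C E (to_ran (defect_star A) (adjoint (op_word A alpha)
      ((defect A (defect A (hinj j h)) : hpow d HA) k))))) =
    summability.sum (fun v => tensor (fock_basis (k :: v)) (F k v)).
  by congr summability.sum; apply/funext => v; rewrite FE.
under eq_bigr do rewrite sumE.
rewrite fock_addE fock_oppE fock_sumE tensor_basisE.
under eq_bigr do rewrite creation_basis_sumE.
case: w => [|k v]; rewrite ?symbol_coord_nil ?symbol_coord_cons row_op_hinr.
  rewrite eqxx scale1r big1 // addr0 hpow_fst_hinr.
  by rewrite (_ : to_ran (defect C) 0 = 0) ?sub0r//; apply/val_inj; rewrite /= linear0.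
rewrite scale0r oppr0 add0r (bigD1 k)//= eqxx big1 ?addr0; last first.
  by move=> i; rewrite eq_sym => /negPf ->.
by rewrite FE DD hpow_snd_hinr !ffunE adjoint_row_op row_op_hinj.
Qed.

(** The operator chosen by [symbol] and the one with the stated coordinates satisfy the same two
    formulas. These cover both summands of every copy of the lifting space, so linearity gives
    agreement at all D_E x. *)
Lemma symbolE x w : symbol C E (to_ran (defect E) x) w = symbol_coord C E x w.
Proof.
have [t tE] := symbol_exists C_contr E_lift.
have tS := is_symbolP tE.
have [s1 s2] : is_symbol (symbol C E) := @xgetPex _ null_op [set theta | is_symbol theta]
  (ex_intro _ t tS).
have [t1 t2] := tS.
rewrite -tE; congr (l2_fun _ w).
have gen j (h : hsum HC HA) : symbol C E (to_ran (defect E) (hinj j h)) =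
    t (to_ran (defect E) (hinj j h)).
  have -> : h = 1 *: hinl HA h.1 + hinr HC h.2.
    by rewrite scale1r [LHS]surjective_pairing; congr pair; rewrite /= ?addr0 ?add0r.
  rewrite hinj_linear to_ran_linear (linearP (symbol C E)) (linearP t).
  congr (_ *: _ + _); first exact: (etrans (s1 j h.1) (esym (t1 j h.1))).
  exact: (etrans (s2 j h.2) (esym (t2 j h.2))).
rewrite [x]hpow_sum_hinj.
have -> : to_ran (defect E) (\sum_j hinj j (x j)) = \sum_j to_ran (defect E) (hinj j (x j)).
  by apply/val_inj; rewrite /= linear_sum; elim/big_rec2: _ => //= i y z _ ->.
rewrite (linear_sum (symbol C E)) (linear_sum t).
by apply: eq_bigr => j _; exact: gen.
Qed.

End symbol_values.

(** * Equivalent liftings and equivalent symbols *)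

Section defect_injective.
Context {R : realType} {d : nat} {H : hilbertType R}.

(** As D_C is Hermitian, u - v is orthogonal to the range of D_C, which is dense in the defect
    space. *)
Lemma defect_inj (C : 'I_d -> {bounded H -> H}) (u v : subspace_of (defect_space C)) :
  row_contraction C -> defect C (subspace_val u) = defect C (subspace_val v) -> u = v.
Proof.
move=> /row_contractionP cC uv; have [hD _] := defectP cC.
apply/eqP; rewrite -subr_eq0; apply/eqP; apply: (total_dot0 (@total_to_ran _ _ _ (defect C))) => x.
by rewrite hdotBr !subspace_dotE !hD uv subrr.
Qed.

End defect_injective.

(** * From equivalent liftings to equivalent symbols *)

Section equivalent_liftings.
Context {R : realType} {d : nat} {HC HA HA' : hilbertType R}.
Variables (C : 'I_d -> {bounded HC -> HC}) (E : 'I_d -> {bounded hsum HC HA -> hsum HC HA})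
  (E' : 'I_d -> {bounded hsum HC HA' -> hsum HC HA'}).
Hypotheses (C_contr : row_contraction C) (E_lift : contractive_lifting C E)
  (E'_lift : contractive_lifting C E').
Variable U : {bounded HA -> HA'}.
Hypothesis U_unitary : unitary U.
Hypothesis U_equiv : forall i (x : hsum HC HA),
  ((E i x).1, U (E i x).2) = E' i (x.1, U x.2) :> hsum HC HA'.

Let UB i h : lifting_B E' i h = U (lifting_B E i h).
Proof.
have := congr1 snd (U_equiv i (hinl HA h)).
by rewrite /= linear0.
Qed.

Let UA i h : lifting_A E' i (U h) = U (lifting_A E i h).
Proof. by have := congr1 snd (U_equiv i (hinr HC h)). Qed.

Let UA_adjoint i h : adjoint (lifting_A E' i) (U h) = U (adjoint (lifting_A E i) h).
Proof.
have [Udot Usurj] := U_unitary.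
by apply: adjoint_eq => x'; have [x <-] := Usurj x'; rewrite UA !Udot adjointP.
Qed.

Let UA_word w h : adjoint (op_word (lifting_A E') w) (U h) =
  U (adjoint (op_word (lifting_A E) w) h).
Proof.
elim: w h => [|j w IH] h; last by rewrite !adjoint_op_word UA_adjoint IH.
have adj_id (H : hilbertType R) (y : H) : adjoint (@idfun H) y = y by exact: adjoint_eq.
by rewrite !adj_id.
Qed.

Let U_row_B g : row_op (lifting_B E') g = U (row_op (lifting_B E) g).
Proof. by rewrite /row_op linear_sum; apply: eq_bigr => i _; exact: UB. Qed.

(** The kernel is determined by D_C (kernel h) = B^* h, and B' = U B gives B'^* U = B^*. *)
Let U_kernel h : lifting_kernel C E' (U h) = lifting_kernel C E h.
Proof.
have [Udot _] := U_unitary.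
apply: defect_inj => //; rewrite !defect_lifting_kernel//; apply: adjoint_eq => g.
transitivity (hdot (U (row_op (lifting_B E) g)) (U h)); first by rewrite -U_row_B.
by rewrite Udot adjointP.
Qed.

Let V (x : hpow d (hsum HC HA)) : hpow d (hsum HC HA') :=
  [ffun i => ((x i).1, U (x i).2) : hsum HC HA'].

Let V_fst x : hpow_fst (V x) = hpow_fst x.
Proof. by apply/ffunP => i; rewrite !ffunE. Qed.

Let V_snd x i : hpow_snd (V x) i = U (hpow_snd x i).
Proof. by rewrite !ffunE. Qed.

Let V_row_A x : row_op (lifting_A E') (hpow_snd (V x)) = U (row_op (lifting_A E) (hpow_snd x)).
Proof. by rewrite /row_op linear_sum; apply: eq_bigr => i _; rewrite V_snd UA. Qed.

Let V_row x : (row_op E' (V x)).2 = U (row_op E x).2.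
Proof.
rewrite (row_op_lifting2 E_lift) (row_op_lifting2 E'_lift) V_fst V_row_A U_row_B.
by rewrite (linearD U).
Qed.

Let V_defect x y : hdot (defect E x) (defect E y) = hdot (defect E' (V x)) (defect E' (V y)).
Proof.
have [Udot _] := U_unitary.
rewrite (defect_dot (row_contractionP E_lift.1)) (defect_dot (row_contractionP E'_lift.1)).
congr (_ - _).
  rewrite !hpow_hsum_dot !V_fst; congr (_ + _); rewrite !hpow_dotE.
  by apply: eq_bigr => i _; rewrite !V_snd Udot.
rewrite (row_op_lifting_dot E_lift) (row_op_lifting_dot E'_lift) !V_fst; congr (_ + _).
by rewrite !U_row_B !V_row_A -!(linearD U) Udot.
Qed.

Let V_coord x w : symbol_coord C E' (V x) w = symbol_coord C E x w.
Proof.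
case: w => [|j w]; rewrite ?symbol_coord_nil ?symbol_coord_cons V_row.
  by rewrite V_fst U_kernel.
by rewrite V_snd UA_adjoint -(linearB U) UA_word U_kernel.
Qed.

Lemma equivalent_liftings_symbols : symbol_equiv (symbol C E) (symbol C E').
Proof.
have V_surj y : exists x, V x = y.
  have [_ Usurj] := U_unitary.
  have /choice[s sP] : forall i, exists h, U h = (y i).2 by move=> i; exact: Usurj.
  exists [ffun i => ((y i).1, s i) : hsum HC HA].
  by apply/ffunP => i; rewrite !ffunE/= sP -surjective_pairing.
(* [V] is onto, so these vectors are all the D_{E'} y. *)
have tV : total (fun x => to_ran (defect E') (V x)).
  rewrite /total -(total_to_ran (defect E')); congr (closure (linear_span _)).
  apply/seteqP; split => _ [x _ <-]; first by exists (V x).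
  by have [y <-] := V_surj x; exists y.
have [v [v_unitary vP]] := gram_unitary (total_to_ran (defect E)) tV V_defect.
exists v => // t.
apply: (@total_eq _ _ _ _ _ (symbol C E) (symbol C E' \o v) (total_to_ran (defect E))) => x /=.
by apply: fock_tensorP => w; rewrite vP !symbolE// V_coord.
Qed.

End equivalent_liftings.

(** * From equivalent symbols to equivalent liftings *)

Section equivalent_symbols.
Context {R : realType} {d : nat} {HC HA : hilbertType R}.
Variables (C : 'I_d -> {bounded HC -> HC}) (E : 'I_d -> {bounded hsum HC HA -> hsum HC HA}).
Hypotheses (C_contr : row_contraction C) (E_lift : contractive_lifting C E).
Local Notation A := (lifting_A E).
Local Notation B := (lifting_B E).

Definition lifting_word (w : word d) (g : hpow d HC) : HA := op_word A w (row_op B g).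

(* The vector y with theta^* (e_w \otimes D_C g) = D_E y. *)
Definition symbol_preimage (w : word d) (g : hpow d HC) : hpow d (hsum HC HA) :=
  if w is j :: v then hinj j (hinr HC (lifting_word v g))
  else [ffun i => hinl HA (g i)].

Lemma symbol_preimage_nil_fst g : hpow_fst (symbol_preimage [::] g) = g.
Proof. by apply/ffunP => i; rewrite !ffunE. Qed.

Lemma symbol_preimage_nil_snd g : hpow_snd (symbol_preimage [::] g) = 0.
Proof. by apply/ffunP => i; rewrite !ffunE. Qed.

Lemma symbol_preimage_cons_fst j w g : hpow_fst (symbol_preimage (j :: w) g) = 0.
Proof. exact: hpow_fst_hinr. Qed.

Lemma symbol_preimage_cons_snd j w g :
  hpow_snd (symbol_preimage (j :: w) g) = hinj j (lifting_word w g).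
Proof. exact: hpow_snd_hinr. Qed.

Lemma row_op_symbol_preimage1 w g :
  (row_op E (symbol_preimage w g)).1 = if w is [::] then row_op C g else 0.
Proof.
rewrite (row_op_lifting1 E_lift); case: w => [|j w].
  by rewrite symbol_preimage_nil_fst.
by rewrite symbol_preimage_cons_fst (linear0 (row_op C)).
Qed.

Lemma row_op_symbol_preimage2 w g : (row_op E (symbol_preimage w g)).2 = lifting_word w g.
Proof.
rewrite (row_op_lifting2 E_lift); case: w => [|j w].
  by rewrite symbol_preimage_nil_fst symbol_preimage_nil_snd (linear0 (row_op A)) addr0.
rewrite symbol_preimage_cons_fst symbol_preimage_cons_snd (linear0 (row_op B)) add0r.
by rewrite row_op_hinj.
Qed.

Lemma lifting_kernel_dot h g :
  hdot (lifting_kernel C E h) (to_ran (defect C) g) = hdot h (row_op B g).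
Proof.
have [hD _] := defectP (row_contractionP C_contr).
by rewrite subspace_dotE -hD defect_lifting_kernel// adjointPr.
Qed.

Lemma hdot_hinj (H : hilbertType R) (x : hpow d H) j h : hdot x (hinj j h) = hdot (x j) h.
Proof.
rewrite hpow_dotE (bigD1 j)//= ffunE eqxx big1 ?addr0// => i /negPf ij.
by rewrite ffunE ij linear0r.
Qed.

(** With y = (E x)_A, both sides are <D_C x_C, D_C g> - <y, B g> at the empty word and <(x_A)_j -
    A_j^* y, A_v B g> at the word j v. *)
Lemma symbol_coord_dot x w g : hdot (symbol_coord C E x w) (to_ran (defect C) g) =
  hdot (defect E x) (defect E (symbol_preimage w g)).
Proof.
rewrite (defect_dot (row_contractionP E_lift.1)) hpow_hsum_dot.
rewrite [hdot (row_op E x) _]hsum_dotE row_op_symbol_preimage1 row_op_symbol_preimage2.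
case: w => [|j w]; rewrite ?symbol_coord_nil ?symbol_coord_cons.
  rewrite symbol_preimage_nil_fst symbol_preimage_nil_snd linear0r addr0.
  rewrite hdotBl lifting_kernel_dot to_ran_dot (defect_dot (row_contractionP C_contr)).
  by rewrite (row_op_lifting1 E_lift) opprD addrA.
rewrite symbol_preimage_cons_fst symbol_preimage_cons_snd !linear0r !add0r hdot_hinj.
by rewrite lifting_kernel_dot adjointPr hdotBl adjointPr.
Qed.

Lemma symbol_dot (t : subspace_of (defect_space E)) w g :
  hdot (symbol C E t w) (to_ran (defect C) g) =
  hdot t (to_ran (defect E) (symbol_preimage w g)).
Proof.
have [p pE] := @fock_coord_bounded R d (subspace_of (defect_space C)) w.
(* As a bounded operator, the coordinate of the symbol has an adjoint, so it suffices to compare two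
   vectors against the total family of the D_E x. *)
rewrite -pE -[p _]/((p \o symbol C E) t) adjointP; congr (hdot t _).
apply/eqP; rewrite -subr_eq0; apply/eqP.
apply: (total_dot0 (total_to_ran (defect E))) => x.
by rewrite hdotBr -adjointP /= pE symbolE// symbol_coord_dot to_ran_dot subrr.
Qed.

(** The second component of E_w x lies in the span of these vectors: for a first letter j it is B_j
    applied to the previous first component, a vector of the empty word, plus A_j applied to the
    previous second one. Density then passes to the second summand by projection. *)
Lemma lifting_word_total : minimal_lifting E ->
  total (fun p : word d * hpow d HC => lifting_word p.1 p.2).
Proof.
move=> mE; apply/seteqP; split => // h _; apply/closure_normP => e e0.
have /closure_normP/(_ e e0)[q qS hq] : closure (linear_span
    [set op_word E alpha (hinl HA x) | alpha in [set: word d] & x in [set: HC]]) (hinr HC h).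
  by rewrite mE.
exists q.2; last first.
  apply: le_lt_trans hq; rewrite -ler_sqr ?nnegrE// !hnormE hsum_dotE lerDr.
  exact: dnorm_ge0.
apply: (@linear_spanP _ _ _ (fun q : hsum HC HA => linear_span _ q.2)) qS => /=.
- exact: linear_span0.
- by move=> a u v; exact: linear_span_linear.
move=> _ [w _ [x _ <-]]; elim: w => [|j w IH] /=; first exact: linear_span0.
rewrite (contractive_lifting_blocks E_lift)/= -[X in _ (X + _)]scale1r.
apply: linear_span_linear.
  apply: linear_span_gen; exists ([::], hinj j (op_word E w (hinl HA x)).1) => //=.
  by rewrite /lifting_word row_op_hinj.
apply: (@linear_spanP _ _ _ (fun u => linear_span _ (A j u))) IH => [|a u v Au Av|].
- by rewrite (linear0 (A j)); exact: linear_span0.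
- by rewrite (linearP (A j)); exact: linear_span_linear.
move=> _ [[v g] _ <-]; apply: linear_span_gen.
by exists (j :: v, g).
Qed.

End equivalent_symbols.

Section gram_of_words.
Context {R : realType} {d : nat} {HC HA HA' : hilbertType R}.
Variables (C : 'I_d -> {bounded HC -> HC}) (E : 'I_d -> {bounded hsum HC HA -> hsum HC HA})
  (E' : 'I_d -> {bounded hsum HC HA' -> hsum HC HA'}).
Hypotheses (C_contr : row_contraction C) (E_lift : contractive_lifting C E)
  (E'_lift : contractive_lifting C E').

(** The identity <D y, D y'> = <y, y'> - <F y, F y'>, solved for the second components of F y and F
    y'. *)
Let preimage_dot (HB : hilbertType R) (F : 'I_d -> {bounded hsum HC HB -> hsum HC HB})
    (F_lift : contractive_lifting C F) w g w' g' :
  hdot (lifting_word F w g) (lifting_word F w' g') =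
  hdot (symbol_preimage F w g) (symbol_preimage F w' g')
  - hdot (if w is [::] then row_op C g else 0) (if w' is [::] then row_op C g' else 0)
  - hdot (defect F (symbol_preimage F w g)) (defect F (symbol_preimage F w' g')).
Proof.
rewrite (defect_dot (row_contractionP F_lift.1)).
rewrite [hdot (row_op F _) (row_op F _)]hsum_dotE !(row_op_symbol_preimage1 F_lift).
rewrite !(row_op_symbol_preimage2 F_lift).
by ring.
Qed.

Lemma lifting_word_gram
    (v : {bounded subspace_of (defect_space E) -> subspace_of (defect_space E')}) :
  unitary v -> (forall t, symbol C E t = symbol C E' (v t)) ->
  forall w g w' g', hdot (lifting_word E w g) (lifting_word E w' g') =
    hdot (lifting_word E' w g) (lifting_word E' w' g').
Proof.
move=> [vdot vsurj] vE.
(* Every vector is some [v t], and testing both sides against it gives the same coordinate of the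
   common value of the symbols. *)
have vz w g : v (to_ran (defect E) (symbol_preimage E w g)) =
    to_ran (defect E') (symbol_preimage E' w g).
  apply: hdot_eqP => t'; have [t <-] := vsurj t'.
  by rewrite vdot -(symbol_dot C_contr E_lift) vE -(symbol_dot C_contr E'_lift).
have zz w g w' g' :
    hdot (defect E (symbol_preimage E w g)) (defect E (symbol_preimage E w' g')) =
    hdot (defect E' (symbol_preimage E' w g)) (defect E' (symbol_preimage E' w' g')).
  by rewrite -!to_ran_dot -!vz vdot.
(* Only <y, y'> still depends on the lifting. It is <g, g'> for two empty words, zero if exactly one
   is empty, and for first letters j and k it is zero unless j = k, when the tails give the
   induction hypothesis. *)
elim=> [|j w IH] g w' g'; rewrite (preimage_dot E_lift) (preimage_dot E'_lift) zz;
  congr (_ - _ - _); rewrite !hpow_hsum_dot.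
  rewrite !symbol_preimage_nil_fst !symbol_preimage_nil_snd !linear0l !addr0.
  by case: w' => [|k w']; rewrite ?symbol_preimage_nil_fst ?symbol_preimage_cons_fst.
rewrite !symbol_preimage_cons_fst !symbol_preimage_cons_snd !linear0l !add0r.
case: w' => [|k w']; first by rewrite !symbol_preimage_nil_snd !linear0r.
rewrite !symbol_preimage_cons_snd !hdot_hinj !ffunE.
by case: eqP => _; rewrite ?IH// !linear0l.
Qed.

Lemma equivalent_symbols_liftings : minimal_lifting E -> minimal_lifting E' ->
  symbol_equiv (symbol C E) (symbol C E') -> lifting_equiv E E'.
Proof.
move=> E_min E'_min [v v_unitary vE].
have tE := lifting_word_total E_lift E_min.
have tE' := lifting_word_total E'_lift E'_min.
have [|U [U_unitary UE]] := gram_unitary tE tE'.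
  by move=> [w g] [w' g'] /=; exact: (lifting_word_gram v_unitary vE).
have {}UE w g : U (lifting_word E w g) = lifting_word E' w g by exact: (UE (w, g)).
exists U => // i x.
rewrite (contractive_lifting_blocks E_lift) (contractive_lifting_blocks E'_lift)/=.
congr pair; rewrite (linearD U); congr (_ + _).
  (* At the empty word, a vector supported in the i-th copy isolates B_i. *)
  have := UE [::] (hinj i x.1); rewrite /lifting_word /=.
  by rewrite !row_op_hinj.
apply: (@total_eq _ _ _ _ _ (U \o lifting_A E i) (lifting_A E' i \o U) tE) => -[w g] /=.
by rewrite UE; exact: (UE (i :: w)).
Qed.

End gram_of_words.

Theorem theorem6p2 (R : realType) (d : nat) (HC HA HA' : hilbertType R)
    (C : 'I_d -> {bounded HC -> HC})
    (E : 'I_d -> {bounded hsum HC HA -> hsum HC HA})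
    (E' : 'I_d -> {bounded hsum HC HA' -> hsum HC HA'}) :
  (0 < d)%N ->
  row_contraction C ->
  contractive_lifting C E -> minimal_lifting E ->
  contractive_lifting C E' -> minimal_lifting E' ->
  lifting_equiv E E' <-> symbol_equiv (symbol C E) (symbol C E').
Proof.
move=> _ C_contr E_lift E_min E'_lift E'_min; split=> [[U U_unitary U_equiv]|].
  exact: (equivalent_liftings_symbols C_contr E_lift E'_lift U_unitary U_equiv).
exact: (equivalent_symbols_liftings C_contr E_lift E'_lift E_min E'_min).
Qed.
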